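(* Let $C\in\mathbb{S}^n$, let $\mathcal{A}:\mathbb{S}^n\to\mathbb{R}^m$ be linear, and let $b\in\mathbb{R}^m$. Suppose that the primal solution set $\mathcal{X}_\star$ and the dual solution set $\mathcal{Y}_\star$ are both compact, and that strong duality and strict complementarity hold. Fix a starting point $y_1\in\mathbb{R}^m$. Then the bundle method with cut aggregation, with properly chosen parameters, produces an approximate primal-dual solution pair after $\widetilde O(1/\epsilon)$ iterations. Precisely: there are constants $K,k>0$, independent of $\epsilon$, such that for every $\epsilon>0$ there are parameters $\alpha>0$, $\rho>0$, $\beta\in(0,1)$ for which the bundle method started at $y_1$ produces, at some iteration index $$t\le K\,(1+1/\epsilon)\,\bigl(\log(2+1/\epsilon)\bigr)^k ,$$ a pair $(X_t,y_t)$ satisfying (approximate primal feasibility) $\|b-\mathcal{A}X_t\|^2\le\epsilon$ and $X_t\succeq 0$; (approximate dual feasibility) $\lambda_{\min}(C-\mathcal{A}^*y_t)\ge-\epsilon$; (approximate primal-dual optimality) $|\langle b,y_t\rangle-\langle C,X_t\rangle|\le\sqrt{\epsilon}$.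
   Context: $\mathbb{S}^n$ is the space of real symmetric $n\times n$ matrices with the trace inner product, $\mathbb{R}^m$ carries the dot product and Euclidean norm $\|\cdot\|$, and $\mathcal{A}^*$ is the adjoint of $\mathcal{A}$. Primal problem: maximize $\langle -C,X\rangle$ over $X\in\mathbb{S}^n$ subject to $\mathcal{A}X=b$, $X\succeq0$; its solution set is $\mathcal{X}_\star$. Dual problem: minimize $\langle -b,y\rangle$ over $y\in\mathbb{R}^m$ subject to $\mathcal{A}^*y\preceq C$; its solution set is $\mathcal{Y}_\star$. Strong duality: there is a pair $(X_\star,y_\star)\in\mathcal{X}_\star\times\mathcal{Y}_\star$ with $\langle -C,X_\star\rangle=\langle -b,y_\star\rangle$. Strict complementarity: there is a pair $(X_\star,y_\star)\in\mathcal{X}_\star\times\mathcal{Y}_\star$ with $\operatorname{rank}(X_\star)+\operatorname{rank}(C-\mathcal{A}^*y_\star)=n$. Penalized dual objective, for $\alpha>0$: $F(y)=\langle -b,y\rangle-\alpha\min\{\lambda_{\min}(C-\mathcal{A}^*y),0\}$. Bundle method with cut aggregation (parameters $\alpha>0$, $\rho>0$, $\beta\in(0,1)$, starting point $y_1\in\mathbb{R}^m$). Initialize $z_1=y_1$, $X_1=0$, $\bar F^1\equiv-\infty$. For $t=1,2,\dots$: (1) Let $v_t$ be a unit eigenvector of $C-\mathcal{A}^*z_t$ for its smallest eigenvalue if $\lambda_{\min}(C-\mathcal{A}^*z_t)\le0$, and $v_t=0$ otherwise; set $g_t=-b+\alpha\mathcal{A}(v_tv_t^* )\in\partial F(z_t)$.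 Let $\ell_t(y)=F(z_t)+\langle g_t,y-z_t\rangle$ and $\widetilde F^t(y)=\max\{\ell_t(y),\bar F^t(y)\}$. (2) Let $z_{t+1}$ be the minimizer over $y$ of $\widetilde F^t(y)+\frac{\rho}{2}\|y-y_t\|^2$, and let $\theta_t\in[0,1]$ be a corresponding optimality multiplier, i.e. $\theta_t g_t+(1-\theta_t)\nabla\bar F^t+\rho(z_{t+1}-y_t)=0$ and $\theta_t\ell_t(z_{t+1})+(1-\theta_t)\bar F^t(z_{t+1})=\widetilde F^t(z_{t+1})$ (for $t=1$: $\theta_1=1$, and terms with factor $1-\theta_1$ are omitted). (3) If $F(z_{t+1})\le F(y_t)-\beta\bigl(F(y_t)-\widetilde F^t(z_{t+1})\bigr)$, set $y_{t+1}=z_{t+1}$ (iteration $t$ is a descent step); otherwise set $y_{t+1}=y_t$ (null step). (4) Set $\bar F^{t+1}=\theta_t\ell_t+(1-\theta_t)\bar F^t$ (an affine function) and $X_{t+1}=\theta_t\alpha v_tv_t^*+(1-\theta_t)X_t$. The notation $\widetilde O(\cdot)$ hides logarithmic factors in $1/\epsilon$ and constants independent of $\epsilon$. *)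

(* Defs.v *)
From HB Require Import structures.
From mathcomp Require Import all_boot all_order all_algebra.
From mathcomp Require Import all_classical all_reals all_analysis.
From mathcomp Require Import ring.

Set Implicit Arguments.
Unset Strict Implicit.
Unset Printing Implicit Defensive.

Import Order.TTheory GRing.Theory Num.Theory.
Import numFieldNormedType.Exports.

Local Open Scope classical_set_scope.
Local Open Scope ring_scope.

Section SymmetricMatrices.
Variables (R : realType) (n : nat).

Definition sympred := [qualify a M : 'M[R]_n | M^T == M].

Lemma sympred_submod : submod_closed sympred.
Proof.
split=> [|a M N]; first by rewrite qualifE /= trmx0.
rewrite !qualifE /= => /eqP symM /eqP symN.
by rewrite linearP /= symM symN.
Qed.

HB.instance Definition _ := GRing.isSubmodClosed.Build R 'M[R]_n
  (has_quality 1 sympred) sympred_submod.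

Record symmx := SymMx { symval :> 'M[R]_n ; symvalP : symval \is a sympred }.

HB.instance Definition _ := [isSub for symval].
HB.instance Definition _ := [Choice of symmx by <:].
HB.instance Definition _ := [SubChoice_isSubLmodule of symmx by <:].

Lemma symval_is_linear : linear symval.
Proof. by []. Qed.

HB.instance Definition _ :=
  GRing.isLinear.Build R symmx 'M[R]_n *:%R symval symval_is_linear.

Lemma sympart_subproof (M : 'M[R]_n) : 2^-1 *: (M + M^T) \is a sympred.
Proof. by rewrite qualifE /= linearZ linearD /= trmxK addrC. Qed.

Definition sympart (M : 'M[R]_n) : symmx := SymMx (sympart_subproof M).

Lemma outer_subproof (v : 'cV[R]_n) : v *m v^T \is a sympred.
Proof. by rewrite qualifE /= trmx_mul trmxK. Qed.

Definition outer (v : 'cV[R]_n) : symmx := SymMx (outer_subproof v).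

Definition mxip (X Y : symmx) : R := \tr (X *m Y).

End SymmetricMatrices.

Section EuclideanSpace.
Variables (R : realType) (m : nat).

Definition dotv (x y : 'cV[R]_m) : R := \sum_i x i 0 * y i 0.

(* The library norm on matrices is the max norm. *)
Definition enorm (x : 'cV[R]_m) : R := Num.sqrt (dotv x x).

(* The pair (g, c) stands for the affine function y |-> <g, y> + c, so that
   affine combinations are those of the product module. *)
Definition affine : Type := ('cV[R]_m * R)%type.

Definition aff_grad (f : affine) : 'cV[R]_m := f.1.

Definition aff_eval (f : affine) (y : 'cV[R]_m) : R := dotv (aff_grad f) y + f.2.

(* y |-> c + <g, y - z> *)
Definition aff_at (c : R) (g z : 'cV[R]_m) : affine := (g, c - dotv g z).

End EuclideanSpace.

Section Spectrum.
Variables (R : realType) (n : nat).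

Definition psd (X : symmx R n) : Prop :=
  forall u : 'cV[R]_n, 0 <= dotv u (X *m u).

Definition loewner_le (X Y : symmx R n) : Prop := psd (Y - X).

(* For n > 0 this is a minimum: a real symmetric matrix has a finite nonempty
   set of (real) eigenvalues. *)
Definition lambda_min (X : symmx R n) : R := inf [set a | eigenvalue X a].

End Spectrum.

Section SDP.
Variables (R : realType) (n m : nat).
Variables (C : symmx R n) (A : {linear symmx R n -> 'cV[R]_m}) (b : 'cV[R]_m).

Lemma adjoint_subproof (y : 'cV[R]_m) :
  \matrix_(i, j) dotv y (A (sympart (delta_mx i j))) \is a @sympred R n.
Proof.
rewrite qualifE /=; apply/eqP/matrixP => i j; rewrite !mxE.
congr (dotv y (A _)); apply: val_inj => /=.
by rewrite !trmx_delta addrC.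
Qed.

(* See adjointP for the defining property. *)
Definition adjoint (y : 'cV[R]_m) : symmx R n := SymMx (adjoint_subproof y).

Definition primal_feasible (X : symmx R n) : Prop := A X = b /\ psd X.

Definition primal_sol : set (symmx R n) :=
  [set X | primal_feasible X /\
     forall X', primal_feasible X' -> mxip (- C) X' <= mxip (- C) X].

Definition dual_feasible (y : 'cV[R]_m) : Prop := loewner_le (adjoint y) C.

Definition dual_sol : set 'cV[R]_m :=
  [set y | dual_feasible y /\
     forall y', dual_feasible y' -> dotv (- b) y <= dotv (- b) y'].

Definition strong_duality : Prop :=
  exists X y, [/\ primal_sol X, dual_sol y & mxip (- C) X = dotv (- b) y].

Definition strict_complementarity : Prop :=
  exists X y, [/\ primal_sol X, dual_sol y &
    (\rank X + \rank (C - adjoint y)%R = n)%N].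

Section Bundle.
Variables (alpha rho beta : R) (y1 : 'cV[R]_m).

Definition penalized (y : 'cV[R]_m) : R :=
  dotv (- b) y - alpha * Num.min (lambda_min (C - adjoint y)) 0.

Definition eigvec_choice (z : 'cV[R]_m) (v : 'cV[R]_n) : Prop :=
  if lambda_min (C - adjoint z) <= 0
  then enorm v = 1 /\ (C - adjoint z)%R *m v = lambda_min (C - adjoint z) *: v
  else v = 0.

Definition subgrad (v : 'cV[R]_n) : 'cV[R]_m := - b + alpha *: A (outer v).

Definition cut (z : 'cV[R]_m) (v : 'cV[R]_n) : affine R m :=
  aff_at (penalized z) (subgrad v) z.

(* max (l, Fbar), where None encodes the function Fbar = -oo *)
Definition model (l : affine R m) (Fbar : option (affine R m)) (y : 'cV[R]_m) : R :=
  if Fbar is Some f then Num.max (aff_eval l y) (aff_eval f y)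
  else aff_eval l y.

(* theta l + (1 - theta) Fbar, the last term being omitted when Fbar = -oo *)
Definition aggregate (theta : R) (l : affine R m) (Fbar : option (affine R m)) :
    affine R m :=
  if Fbar is Some f then theta *: l + (1 - theta) *: f else theta *: l.

(* A run of the method: eigenvectors and multipliers are arbitrary admissible
   choices. Iterations are numbered from 1; the values at index 0 are
   irrelevant. *)
Record bundle_run := BundleRun {
  run_y : nat -> 'cV[R]_m ;
  run_z : nat -> 'cV[R]_m ;
  run_v : nat -> 'cV[R]_n ;
  run_theta : nat -> R ;
  run_Fbar : nat -> option (affine R m) ;
  run_X : nat -> symmx R n ;

  run_cut := fun t => cut (run_z t) (run_v t) ;
  run_model := fun t => model (run_cut t) (run_Fbar t) ;
  run_agg := fun t => aggregate (run_theta t) (run_cut t) (run_Fbar t) ;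

  run_y1 : run_y 1 = y1 ;
  run_z1 : run_z 1 = y1 ;
  run_X1 : run_X 1 = 0 ;
  run_Fbar1 : run_Fbar 1 = None ;

  run_vP : forall t, (0 < t)%N -> eigvec_choice (run_z t) (run_v t) ;

  run_zP : forall t, (0 < t)%N -> forall y,
    run_model t (run_z t.+1) + rho / 2 * enorm (run_z t.+1 - run_y t) ^+ 2
    <= run_model t y + rho / 2 * enorm (y - run_y t) ^+ 2 ;

  run_theta_itv : forall t, (0 < t)%N -> 0 <= run_theta t <= 1 ;
  run_theta1 : run_theta 1 = 1 ;
  run_theta_grad : forall t, (0 < t)%N ->
    aff_grad (run_agg t) + rho *: (run_z t.+1 - run_y t) = 0 ;
  run_theta_val : forall t, (0 < t)%N ->
    aff_eval (run_agg t) (run_z t.+1) = run_model t (run_z t.+1) ;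

  run_yP : forall t, (0 < t)%N ->
    run_y t.+1 =
      if penalized (run_z t.+1) <= penalized (run_y t)
           - beta * (penalized (run_y t) - run_model t (run_z t.+1))
      then run_z t.+1 else run_y t ;

  run_FbarP : forall t, (0 < t)%N -> run_Fbar t.+1 = Some (run_agg t) ;
  run_XP : forall t, (0 < t)%N ->
    run_X t.+1 = (run_theta t * alpha) *: outer (run_v t)
                 + (1 - run_theta t) *: run_X t
}.

End Bundle.

End SDP.

Lemma adjointP (R : realType) (n m : nat)
    (A : {linear symmx R n -> 'cV[R]_m}) (y : 'cV[R]_m) (X : symmx R n) :
  mxip (adjoint A y) X = dotv y (A X).
Proof.
have sumX : X = \sum_i \sum_j X i j *: sympart (delta_mx i j).
  apply: val_inj => /=; rewrite linear_sum /=.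
  under eq_bigr do rewrite linear_sum /=.
  apply/matrixP => k l; rewrite summxE.
  have symX : X k l = X l k.
    by rewrite -[in RHS](eqP (symvalP X)) mxE.
  have -> : X k l = \sum_i \sum_j 2^-1 * (X i j * ((k == i) && (l == j))%:R)
                  + \sum_i \sum_j 2^-1 * (X i j * ((l == i) && (k == j))%:R).
    rewrite (bigD1 k) //= (bigD1 l) //= !eqxx mulr1.
    rewrite big1 => [|j /negPf jl]; last by rewrite eq_sym jl !mulr0.
    rewrite big1 => [|i /negPf ik]; last first.
      by rewrite big1 // => j _; rewrite eq_sym ik !mulr0.
    rewrite (bigD1 l) //= (bigD1 k) //= !eqxx mulr1.
    rewrite big1 => [|j /negPf jk]; last by rewrite eq_sym jk !mulr0.
    rewrite big1 => [|i /negPf il]; last first.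
      by rewrite big1 // => j _; rewrite eq_sym il !mulr0.
    by rewrite !addr0 -symX; field.
  rewrite -big_split /=; apply: eq_bigr => i _.
  rewrite -big_split summxE /=; apply: eq_bigr => j _.
  by rewrite !mxE; ring.
rewrite [in RHS]sumX linear_sum /dotv /mxip /mxtrace /=.
have -> : \sum_k y k 0 * (\sum_i A (\sum_j X i j *: sympart (delta_mx i j))) k 0
    = \sum_i \sum_j X i j * \sum_k y k 0 * A (sympart (delta_mx i j)) k 0.
  under eq_bigr do rewrite summxE mulr_sumr.
  rewrite exchange_big; apply: eq_bigr => i _ /=.
  under eq_bigr do rewrite linear_sum summxE mulr_sumr.
  rewrite exchange_big; apply: eq_bigr => j _ /=.
  by rewrite mulr_sumr; apply: eq_bigr => k _; rewrite linearZ mxE mulrCA.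
apply: eq_bigr => i _; rewrite mxE; apply: eq_bigr => j _.
by rewrite -[in LHS](eqP (symvalP X)) !mxE mulrC.
Qed.

(* Main.v *)
(** Take [alpha = \tr X* + 1], [beta = 1/2] and a constant [rho], so that only the
    stopping index depends on [eps].

    Strict complementarity makes [X* + S*] positive definite. For [y] with gap
    [F y - F*] bounded, a linear error bound on the range of [X*] gives [y'] whose
    slack vanishes on that range, and a convex combination of [y'] with [y*]
    repairs feasibility; hence [F] grows quadratically away from the compact dual
    solution set. With [rho] below the inverse of the growth constant, the gap
    [F y_t - F*] is at most twice the proximal gap
    [d_t = F y_t - min (model + rho/2 |. - y_t|^2)], which also controls the primal
    residual. A descent step shrinks [F y_t - F*] by a factor [3/4], and a null step
    gives [d_(t+1) <= d_t - kappa d_t^2]; so there are [O(log (1/eps))] descent steps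
    separated by runs of [O(1/eps)] null steps until [d_t = O(eps)]. The aggregate
    affine function is the Lagrangian at [X_(t+1)], which turns [d_t = O(eps)] into
    the three accuracy bounds. *)

Require Import Defs.
From HB Require Import structures.
From mathcomp Require Import all_boot all_order all_algebra.
From mathcomp Require Import all_classical all_reals all_analysis.
From mathcomp Require Import ring lra.
Import Order.TTheory GRing.Theory Num.Theory.
Import numFieldNormedType.Exports.
Local Open Scope classical_set_scope.
Local Open Scope ring_scope.

Set Implicit Arguments.
Unset Strict Implicit.
Unset Printing Implicit Defensive.

(** * Euclidean inner product and norm *)

Section DotProduct.
Variables (R : realType) (m : nat).
Implicit Types (x y z : 'cV[R]_m) (a : R).

Lemma dotvE x y : dotv x y = (x^T *m y) 0 0.
Proof. by rewrite mxE; apply: eq_bigr => i _; rewrite mxE. Qed.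

Lemma dotvC x y : dotv x y = dotv y x.
Proof. by apply: eq_bigr => i _; rewrite mulrC. Qed.

Lemma dotvDl x y z : dotv (x + y) z = dotv x z + dotv y z.
Proof. by rewrite !dotvE linearD mulmxDl mxE. Qed.

Lemma dotvDr x y z : dotv x (y + z) = dotv x y + dotv x z.
Proof. by rewrite !dotvE mulmxDr mxE. Qed.

Lemma dotvZl a x y : dotv (a *: x) y = a * dotv x y.
Proof. by rewrite !dotvE linearZ /= -scalemxAl mxE. Qed.

Lemma dotvZr a x y : dotv x (a *: y) = a * dotv x y.
Proof. by rewrite dotvC dotvZl dotvC. Qed.

Lemma dotvNl x y : dotv (- x) y = - dotv x y.
Proof. by rewrite -scaleN1r dotvZl mulN1r. Qed.

Lemma dotvNr x y : dotv x (- y) = - dotv x y.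
Proof. by rewrite dotvC dotvNl dotvC. Qed.

Lemma dotvBl x y z : dotv (x - y) z = dotv x z - dotv y z.
Proof. by rewrite dotvDl dotvNl. Qed.

Lemma dotvBr x y z : dotv x (y - z) = dotv x y - dotv x z.
Proof. by rewrite dotvDr dotvNr. Qed.

Lemma dotv0l x : dotv 0 x = 0.
Proof. by rewrite -(scale0r 0) dotvZl mul0r. Qed.

Lemma dotv0r x : dotv x 0 = 0.
Proof. by rewrite dotvC dotv0l. Qed.

Lemma dotvv_ge0 x : 0 <= dotv x x.
Proof. by apply: sumr_ge0 => i _; rewrite -expr2 sqr_ge0. Qed.

Lemma sqr_coord_le_dotvv x i : x i 0 ^+ 2 <= dotv x x.
Proof.
rewrite /dotv (bigD1 i) //= -expr2 lerDl.
by apply: sumr_ge0 => j _; rewrite -expr2 sqr_ge0.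
Qed.

Lemma dotvv_le0 x : dotv x x <= 0 -> x = 0.
Proof.
move=> x0; apply/matrixP => i j; rewrite (ord1 j) mxE.
have := le_trans (sqr_coord_le_dotvv x i) x0.
by rewrite real_exprn_even_le0 ?num_real //= => /eqP.
Qed.

Lemma dotvvD x y : dotv (x + y) (x + y) = dotv x x + 2 * dotv x y + dotv y y.
Proof. by rewrite dotvDl !dotvDr (dotvC y x); ring. Qed.

Lemma dotvvB x y : dotv (x - y) (x - y) = dotv x x - 2 * dotv x y + dotv y y.
Proof. by rewrite dotvvD dotvNr dotvNl dotvNr; ring. Qed.

Lemma dotvvN x : dotv (- x) (- x) = dotv x x.
Proof. by rewrite dotvNl dotvNr opprK. Qed.

Lemma dotvvZ a x : dotv (a *: x) (a *: x) = a ^+ 2 * dotv x x.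
Proof. by rewrite dotvZl dotvZr; ring. Qed.

Lemma dotvvD_le x y :
  dotv (x + y) (x + y) <= 2 * dotv x x + 2 * dotv y y.
Proof. by have := dotvv_ge0 (x - y); rewrite dotvvB dotvvD; lra. Qed.

Lemma enorm_ge0 x : 0 <= enorm x.
Proof. exact: sqrtr_ge0. Qed.

Lemma enorm_sqr x : enorm x ^+ 2 = dotv x x.
Proof. by rewrite sqr_sqrtr ?dotvv_ge0. Qed.

Lemma enorm_leP x a : 0 <= a -> (enorm x <= a) = (dotv x x <= a ^+ 2).
Proof. by move=> a0; rewrite -enorm_sqr ler_sqr ?nnegrE ?enorm_ge0. Qed.

(** This is [|a x + y|^2 >= 0], expanded and divided by [2 a]. *)
Lemma young_dotv a x y : 0 < a ->
  - dotv y y / (2 * a) <= a / 2 * dotv x x + dotv y x.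
Proof.
move=> a0; have := dotvv_ge0 (a *: x + y).
rewrite dotvvD dotvvZ dotvZl (dotvC y x) => h.
rewrite ler_pdivrMr; last lra.
by apply: le_trans (_ : _ <= a ^+ 2 * dotv x x + 2 * a * dotv x y) _; lra.
Qed.

Lemma dotv_CS_sqr x y : dotv x y ^+ 2 <= dotv x x * dotv y y.
Proof.
have [y0|ny] := eqVneq (dotv y y) 0.
  by rewrite (@dotvv_le0 y) ?y0 // !dotv0r mulr0 expr0n.
have yp : 0 < dotv y y by rewrite lt0r ny dotvv_ge0.
have := dotvv_ge0 (dotv y y *: x - dotv x y *: y).
rewrite dotvvB !dotvvZ dotvZl dotvZr.
rewrite (_ : _ - _ + _ = dotv y y * (dotv x x * dotv y y - dotv x y ^+ 2)); last ring.
by rewrite pmulr_rge0 // subr_ge0.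
Qed.

Lemma dotv_CS x y : `|dotv x y| <= enorm x * enorm y.
Proof.
rewrite -ler_sqr ?nnegrE ?mulr_ge0 ?enorm_ge0 //.
by rewrite exprMn !enorm_sqr real_normK ?num_real // dotv_CS_sqr.
Qed.

Lemma ler_enormD x y : enorm (x + y) <= enorm x + enorm y.
Proof.
rewrite enorm_leP ?addr_ge0 ?enorm_ge0 // dotvvD sqrrD !enorm_sqr.
by have /ler_normlP[_] := dotv_CS x y; rewrite mulr2n; lra.
Qed.

Lemma enormN x : enorm (- x) = enorm x.
Proof. by rewrite /enorm dotvvN. Qed.

Lemma enormZ a x : enorm (a *: x) = `|a| * enorm x.
Proof. by rewrite /enorm dotvvZ sqrtrM ?sqr_ge0 // sqrtr_sqr. Qed.

Lemma enorm0 : enorm (0 : 'cV[R]_m) = 0.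
Proof. by rewrite /enorm dotv0l sqrtr0. Qed.

Lemma ler_enorm_sum (I : Type) (s : seq I) (F : I -> 'cV[R]_m) :
  enorm (\sum_(i <- s) F i) <= \sum_(i <- s) enorm (F i).
Proof.
elim: s => [|i s IH]; first by rewrite !big_nil enorm0.
by rewrite !big_cons (le_trans (ler_enormD _ _)) ?lerD2l.
Qed.

Lemma coord_le_enorm x i : `|x i 0| <= enorm x.
Proof.
rewrite -ler_sqr ?nnegrE ?enorm_ge0 //.
by rewrite real_normK ?num_real // enorm_sqr sqr_coord_le_dotvv.
Qed.

Lemma enorm_le_sum_coord x : enorm x <= \sum_i `|x i 0|.
Proof.
rewrite {1}[x]matrix_sum_delta (le_trans (ler_enorm_sum _ _)) // ler_sum // => i _.
rewrite big_ord1 enormZ /enorm /dotv (bigD1 i) //= big1 => [|j /negPf ji].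
  by rewrite !mxE !eqxx addr0 mulr1 sqrtr1 mulr1.
by rewrite !mxE ji mul0r.
Qed.

End DotProduct.

Lemma dotv_mulmx (R : realType) (m n : nat) (M : 'M[R]_(m, n)) x y :
  dotv x (M *m y) = dotv (M^T *m x) y.
Proof. by rewrite !dotvE trmx_mul trmxK mulmxA. Qed.

Lemma enorm_mulmx_bound (R : realType) (m n : nat) (M : 'M[R]_(m, n)) :
  exists2 c : R, 0 <= c & forall x, enorm (M *m x) <= c * enorm x.
Proof.
exists (\sum_j enorm (col j M)); first by apply: sumr_ge0 => j _; exact: enorm_ge0.
move=> x; have -> : M *m x = \sum_j x j 0 *: col j M.
  apply/matrixP => i k; rewrite (ord1 k) mxE summxE.
  by apply: eq_bigr => j _; rewrite !mxE mulrC.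
rewrite (le_trans (ler_enorm_sum _ _)) // mulr_suml ler_sum // => j _.
by rewrite enormZ mulrC ler_wpM2l ?enorm_ge0 ?coord_le_enorm.
Qed.

(** * Positive semidefinite matrices and the smallest eigenvalue *)

Section PositiveSemidefinite.
Variables (R : realType) (n : nat).
Implicit Types (X Y S : symmx R n) (u v : 'cV[R]_n).

Lemma symval_tr X : X^T = X.
Proof. exact/eqP/(symvalP X). Qed.

Lemma dotv_sym X u v : dotv u (X *m v) = dotv (X *m u) v.
Proof. by rewrite dotv_mulmx symval_tr. Qed.

Lemma quadD X Y u v : dotv u ((X + Y) *m v) = dotv u (X *m v) + dotv u (Y *m v).
Proof. by rewrite -dotvDr -mulmxDl. Qed.

Lemma quadB X Y u v : dotv u ((X - Y) *m v) = dotv u (X *m v) - dotv u (Y *m v).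
Proof. by rewrite -dotvBr -mulmxBl. Qed.

Lemma quadZ a X u v : dotv u ((a *: X) *m v) = a * dotv u (X *m v).
Proof. by rewrite -dotvZr -scalemxAl. Qed.

Lemma quad_comb X u v a b :
  dotv (a *: u + b *: v) (X *m (a *: u + b *: v)) =
  a ^+ 2 * dotv u (X *m u) + 2 * a * b * dotv u (X *m v) + b ^+ 2 * dotv v (X *m v).
Proof.
rewrite mulmxDr -!scalemxAr !dotvDl !dotvDr !dotvZl !dotvZr.
by rewrite (dotv_sym X v u) (dotvC _ u); ring.
Qed.

Lemma quad_outer u v w : dotv v (outer u *m w) = dotv u v * dotv u w.
Proof.
rewrite /= -mulmxA dotv_mulmx dotvE trmx_mul trmxK !dotvE.
by rewrite mxE big_ord1; congr (_ * _); rewrite -!dotvE dotvC.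
Qed.

Lemma psd0 : psd (0 : symmx R n).
Proof. by move=> u; rewrite mul0mx dotv0r. Qed.

Lemma psd_outer u : psd (outer u).
Proof. by move=> v; rewrite quad_outer -expr2 sqr_ge0. Qed.

Lemma psdD X Y : psd X -> psd Y -> psd (X + Y).
Proof. by move=> pX pY u; rewrite quadD addr_ge0 ?pX ?pY. Qed.

Lemma psdZ a X : 0 <= a -> psd X -> psd (a *: X).
Proof. by move=> a0 pX u; rewrite quadZ mulr_ge0 ?pX. Qed.

Lemma psd_CS X u v : psd X ->
  dotv u (X *m v) ^+ 2 <= dotv u (X *m u) * dotv v (X *m v).
Proof.
move=> pX; set q := dotv v _; set b := dotv u (X *m v); set p := dotv u _.
have [q0|nq] := eqVneq q 0.
  have [-> |nb] := eqVneq b 0; first by rewrite expr0n q0 mulr0.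
  have b2 : 0 < b ^+ 2 by rewrite lt0r sqrf_eq0 nb sqr_ge0.
  (* With [q = 0] the form is affine in the coefficient of [v]; this choice gives it the value
     [p - (p + 1) = -1]. *)
  have := pX (1 *: u + (- (p + 1) / (2 * b)) *: v).
  rewrite quad_comb -/q -/b -/p q0 mulr0 addr0 => h.
  suff : 0 <= (-1 : R) by rewrite ler0N1.
  by apply: le_trans h _; rewrite le_eqVlt; apply/orP; left; apply/eqP; field.
have qp : 0 < q by rewrite lt0r nq pX.
have := pX (q *: u + (- b) *: v).
rewrite quad_comb -/q -/b -/p.
rewrite (_ : _ + _ + _ = q * (p * q - b ^+ 2)); last ring.
by rewrite pmulr_rge0 // subr_ge0.
Qed.

Lemma quad_bound (M : 'M[R]_n) :
  exists2 t : R, 0 <= t & forall u, `|dotv u (M *m u)| <= t * dotv u u.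
Proof.
have [c c0 Mc] := enorm_mulmx_bound M; exists c => // u.
rewrite (le_trans (dotv_CS _ _)) // -enorm_sqr expr2 mulrCA.
by rewrite ler_wpM2l ?enorm_ge0.
Qed.

(** In effect [X^2 <= t X]: [psd_CS] at [X u] and [u] gives [|X u|^4 <= t |X u|^2 <u, X u>], and a
    factor [|X u|^2] cancels. *)
Lemma psd_image_bound X t u : psd X -> 0 <= t ->
  (forall w, dotv w (X *m w) <= t * dotv w w) ->
  dotv (X *m u) (X *m u) <= t * dotv u (X *m u).
Proof.
move=> pX t0 Xt; set a := dotv (X *m u) (X *m u).
have [-> |na] := eqVneq a 0; first by rewrite mulr_ge0 ?pX.
have ap : 0 < a by rewrite lt0r na dotvv_ge0.
rewrite -(ler_pM2r ap) -expr2 mulrAC.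
apply: le_trans (psd_CS (X *m u) u pX) _.
by rewrite ler_wpM2r ?pX.
Qed.

Lemma psd_quad_eq0 X u : psd X -> dotv u (X *m u) = 0 -> X *m u = 0.
Proof.
move=> pX q0; have [t t0 Xt] := quad_bound X.
apply/dotvv_le0/(le_trans (psd_image_bound u pX t0 _)); last by rewrite q0 mulr0.
by move=> w; apply: le_trans (Xt w); exact: ler_norm.
Qed.

(** Combines [|u| <= c |X u|], from the inverse, with [|X u|^2 <= t <u, X u>]; the [+ 1] in the
    witness keeps its denominator positive. *)
Lemma psd_unit_margin X : psd X -> (X : 'M[R]_n) \in unitmx ->
  exists2 mu : R, 0 < mu & forall u, mu * dotv u u <= dotv u (X *m u).
Proof.
move=> pX uX; have [t t0 Xt] := quad_bound X.
have [c c0 Xc] := enorm_mulmx_bound (invmx X).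
have d0 : 0 < c ^+ 2 * t + 1 by rewrite ltr_pwDr // mulr_ge0 ?sqr_ge0.
exists (c ^+ 2 * t + 1)^-1; first by rewrite invr_gt0.
move=> u; rewrite mulrC ler_pdivrMr //.
have h1 : dotv (X *m u) (X *m u) <= t * dotv u (X *m u).
  by apply: psd_image_bound => // w; apply: le_trans (Xt w); exact: ler_norm.
have h2 : dotv u u <= c ^+ 2 * dotv (X *m u) (X *m u).
  rewrite -!enorm_sqr -exprMn ler_sqr ?nnegrE ?mulr_ge0 ?enorm_ge0 //.
  by have := Xc (X *m u); rewrite mulKmx.
have q0 := pX u; have := ler_wpM2l (sqr_ge0 c) h1.
by rewrite mulrDr mulr1 mulrA mulrC; lra.
Qed.

Lemma mulmx_delta_col (M : 'M[R]_n) i : M *m delta_mx i 0 = col i M.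
Proof. by rewrite colE. Qed.

Lemma dotv_delta i v : dotv (delta_mx i 0) v = v i 0.
Proof.
rewrite /dotv (bigD1 i) //= mxE !eqxx mul1r big1 ?addr0 // => j /negPf ji.
by rewrite mxE ji mul0r.
Qed.

(** Symmetric Gaussian elimination: a nonzero pivot clears its row and column at the price of one
    more column of [B]. *)
Lemma psd_factor X : psd X ->
  exists k (B : 'M[R]_(n, k)), (X : 'M[R]_n) = B *m B^T.
Proof.
(* Induction on the number [k] of leading rows that may be nonzero; the pivot sits in the last of
   them. *)
suff H k : forall X, psd X -> (forall i j : 'I_n, (k <= i)%N -> X i j = 0) ->
    exists k (B : 'M[R]_(n, k)), (X : 'M[R]_n) = B *m B^T.
  move=> pX; apply: (H n X) => // i j; by rewrite leqNgt ltn_ord.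
elim: k => [|k IH] {}X pX X0.
  exists 0%N, 0; rewrite mul0mx; apply/matrixP => i j; by rewrite X0 ?mxE.
have [kn|kn] := ltnP k n; last first.
  by apply: IH => // i j ki; have := leq_trans kn ki; rewrite leqNgt ltn_ord.
pose i0 := Ordinal kn; pose e : 'cV[R]_n := delta_mx i0 0.
have symX i j : X i j = X j i by rewrite -[in LHS]symval_tr mxE.
have Xe i : (X *m e) i 0 = X i i0 by rewrite mulmx_delta_col mxE.
have qe : dotv e (X *m e) = X i0 i0 by rewrite dotv_delta Xe.
(* By semidefiniteness a zero pivot forces its whole row to vanish. *)
have [a0|na] := eqVneq (X i0 i0) 0.
  have Xe0 : X *m e = 0 by apply: psd_quad_eq0; rewrite ?qe.
  apply: IH => // i j; rewrite leq_eqVlt => /orP[/eqP ki|]; last exact: X0.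
  have -> : i = i0 by apply: val_inj.
  by rewrite symX -Xe Xe0 mxE.
have ap : 0 < X i0 i0 by rewrite lt0r na -qe pX.
(* Schur complement of the pivot; it is positive semidefinite by [psd_CS] at [e]. *)
pose Y := X - (X i0 i0)^-1 *: outer (X *m e).
have [||l [B YB]] := IH Y.
- move=> u; rewrite quadB quadZ quad_outer subr_ge0 -expr2 mulrC ler_pdivrMr //.
  by rewrite -dotv_sym mulrC -qe psd_CS.
- move=> i j; have -> : Y i j = X i j - (X i0 i0)^-1 * (X i i0 * X j i0).
    by rewrite /Y /e mulmx_delta_col !mxE big_ord1 !mxE.
  rewrite leq_eqVlt => /orP[/eqP ki|ki]; last by rewrite !(X0 i) // mul0r mulr0 subrr.
  have -> : i = i0 by apply: val_inj.
  by rewrite (symX j) mulrA mulVf // mul1r subrr.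
exists (l + 1)%N, (row_mx B ((Num.sqrt (X i0 i0))^-1 *: (X *m e))).
rewrite tr_row_mx mul_row_col -YB linearZ /= -scalemxAl -scalemxAr scalerA.
by rewrite -invrM ?unitfE ?sqrtr_eq0 -?ltNge // -expr2 sqr_sqrtr ?ltW // subrK.
Qed.

Lemma sympart_scalar (a : R) : symval (sympart a%:M) = a%:M :> 'M[R]_n.
Proof.
by rewrite /= tr_scalar_mx -mulr2n -[_%:M *+ 2]scaler_nat scalerA mulVf ?scale1r ?pnatr_eq0.
Qed.

(** The supremum [s] of the admissible [a] is admissible, so [X - s I] is positive semidefinite.
    Were it invertible, [psd_unit_margin] would raise [s]; hence [s] is an eigenvalue, and no
    eigenvalue lies below it. *)
Lemma lambda_minP X a : (0 < n)%N ->
  (a <= lambda_min X) <-> (forall u, a * dotv u u <= dotv u (X *m u)).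
Proof.
move=> n0; pose E := [set a | forall u, a * dotv u u <= dotv u (X *m u)].
have [t t0 Xt] := quad_bound X.
have Ene : E !=set0.
  by exists (- t) => u; have /ler_normlP[h _] := Xt u; rewrite mulNr lerNl.
have Eub : has_ubound E.
  exists (X (Ordinal n0) (Ordinal n0)) => c /(_ (delta_mx (Ordinal n0) 0)).
  by rewrite mulmx_delta_col !dotv_delta !mxE !eqxx mulr1.
pose s := sup E.
have Es u : s * dotv u u <= dotv u (X *m u).
  have [u0|nu] := eqVneq (dotv u u) 0.
    by rewrite u0 (dotvv_le0 (_ : dotv u u <= 0)) ?u0 // dotv0l mulr0.
  have up : 0 < dotv u u by rewrite lt0r nu dotvv_ge0.
  by rewrite -ler_pdivlMr //; apply: ge_sup => // c Ec; rewrite ler_pdivlMr.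
have eigs : eigenvalue X s.
  pose Y := X - sympart (s%:M).
  have Yq u : dotv u (Y *m u) = dotv u (X *m u) - s * dotv u u.
    by rewrite quadB sympart_scalar mul_scalar_mx dotvZr.
  have pY : psd Y by move=> u; rewrite Yq subr_ge0.
  have : ~ (Y : 'M[R]_n) \in unitmx.
    move=> /(psd_unit_margin pY)[mu mu0 Ymu].
    have : E (s + mu).
      by move=> u; have := Ymu u; rewrite Yq mulrDl; lra.
    by move=> /(ub_le_sup Eub); rewrite -/s; lra.
  rewrite unitmxE unitfE => /negP; rewrite negbK => /det0P[v v0 vY].
  apply/eigenvalueP; exists v => //; apply/eqP; rewrite -subr_eq0 -vY.
  have -> : symval Y = symval X - s%:M by rewrite -sympart_scalar.
  by rewrite mulmxBr mul_mx_scalar.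
have lbs : lbound [set a | eigenvalue X a] s.
  move=> c /eigenvalueP[v vX v0].
  have v0' : 0 < dotv v^T v^T.
    rewrite lt0r dotvv_ge0 andbT; apply/eqP => h; move/negP: v0; apply.
    by rewrite -[v]trmxK (dotvv_le0 (_ : dotv v^T v^T <= 0)) ?h // trmx0.
  have := Es v^T; have -> : X *m v^T = c *: v^T.
    by rewrite -[symval X]symval_tr -trmx_mul vX linearZ.
  by rewrite dotvZr ler_pM2r.
have ls : lambda_min X = s.
  apply/eqP; rewrite eq_le; apply/andP; split.
    by apply: ge_inf => //; exists s.
  by apply: lb_le_inf => //; exists s.
rewrite ls; split=> [as_ u|Ea]; last exact: ub_le_sup.
by rewrite (le_trans _ (Es u)) // ler_wpM2r ?dotvv_ge0.
Qed.

End PositiveSemidefinite.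

(** * The trace inner product *)

Section InnerProduct.
Variables (R : realType) (n : nat).
Implicit Types (X Y T : symmx R n).

Lemma mxip_outer X u : mxip X (outer u) = dotv u (X *m u).
Proof. by rewrite /mxip /= mulmxA mxtrace_mulC /mxtrace big_ord1 dotvE. Qed.

Lemma mxipDr T X Y : mxip T (X + Y) = mxip T X + mxip T Y.
Proof. by rewrite /mxip /= mulmxDr mxtraceD. Qed.

Lemma mxipZr T a X : mxip T (a *: X) = a * mxip T X.
Proof. by rewrite /mxip /= -scalemxAr mxtraceZ. Qed.

Lemma mxipDl T X Y : mxip (X + Y) T = mxip X T + mxip Y T.
Proof. by rewrite /mxip /= mulmxDl mxtraceD. Qed.

Lemma mxipNl X Y : mxip (- X) Y = - mxip X Y.
Proof. by rewrite /mxip /= mulNmx linearN. Qed.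

Lemma mxipBl T X Y : mxip (X - Y) T = mxip X T - mxip Y T.
Proof. by rewrite mxipDl mxipNl. Qed.

Lemma mxip_factor T X k (B : 'M[R]_(n, k)) : symval X = B *m B^T ->
  mxip T X = \sum_j dotv (col j B) (T *m col j B).
Proof.
move=> XB; rewrite /mxip XB mulmxA mxtrace_mulC; apply: eq_bigr => j _.
rewrite mxE; apply: eq_bigr => i _; rewrite !mxE; congr (_ * _).
by apply: eq_bigr => l _; rewrite mxE.
Qed.

End InnerProduct.

(** * The penalized dual objective and its Lagrangian minorants *)

Section PenalizedDual.
Variables (R : realType) (n m : nat) (n_gt0 : (0 < n)%N).
Variables (C : symmx R n) (A : {linear symmx R n -> 'cV[R]_m}) (b : 'cV[R]_m).
Implicit Types (y z h : 'cV[R]_m) (u v : 'cV[R]_n) (X : symmx R n).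

Definition slack y : symmx R n := C - adjoint A y.

(** For [n > 0], the least [a >= 0] making [slack y + a I] positive semidefinite, by
    [quad_slack_violation] and [violation_le]. *)
Definition violation y : R := - Num.min (lambda_min (slack y)) 0.

Lemma quad_adjoint y u : dotv u (adjoint A y *m u) = dotv y (A (outer u)).
Proof. by rewrite -mxip_outer adjointP. Qed.

Lemma quad_slack y u :
  dotv u (slack y *m u) = dotv u (C *m u) - dotv y (A (outer u)).
Proof. by rewrite quadB quad_adjoint. Qed.

Lemma adjointD y z : adjoint A (y + z) = adjoint A y + adjoint A z.
Proof. by apply/val_inj/matrixP => i j; rewrite !mxE dotvDl. Qed.

Lemma adjointZ a y : adjoint A (a *: y) = a *: adjoint A y.
Proof. by apply/val_inj/matrixP => i j; rewrite !mxE dotvZl. Qed.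

(** Each coordinate of [A (outer u)] is the quadratic form at [u] of the adjoint of a basis
    vector. *)
Lemma enorm_image_outer :
  exists2 c : R, 0 <= c & forall u, enorm (A (outer u)) <= c * dotv u u.
Proof.
have Hk (k : 'I_m) : exists t : R, 0 <= t /\
    forall u, `|A (outer u) k 0| <= t * dotv u u.
  have [t t0 Ht] := quad_bound (adjoint A (delta_mx k 0)).
  exists t; split=> // u; apply: le_trans (Ht u).
  by rewrite quad_adjoint dotv_delta.
have [t Ht] := choice Hk.
exists (\sum_k t k); first by apply: sumr_ge0 => k _; case: (Ht k).
move=> u; rewrite (le_trans (enorm_le_sum_coord _)) // mulr_suml ler_sum // => k _.
by case: (Ht k).
Qed.

Lemma quad_adjoint_bound : exists2 c : R, 0 <= c & forall h u,
  `|dotv u (adjoint A h *m u)| <= c * enorm h * dotv u u.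
Proof.
have [c c0 Ac] := enorm_image_outer; exists c => // h u.
rewrite quad_adjoint (le_trans (dotv_CS _ _)) // mulrAC mulrC.
by rewrite ler_wpM2r ?enorm_ge0.
Qed.

Lemma violation_ge0 y : 0 <= violation y.
Proof. by rewrite /violation oppr_ge0 ge_min lexx orbT. Qed.

Lemma quad_slack_violation y u :
  - violation y * dotv u u <= dotv u (slack y *m u).
Proof.
move: u; apply/(lambda_minP (slack y) _ n_gt0).
by rewrite /violation opprK ge_min lexx.
Qed.

Lemma violation_le y a : 0 <= a ->
  (forall u, - a * dotv u u <= dotv u (slack y *m u)) -> violation y <= a.
Proof.
move=> a0 /(lambda_minP (slack y) _ n_gt0) h.
by rewrite /violation lerNl le_min h oppr_le0.
Qed.

(** The dual Lagrangian [y |-> <-b, y> - <X, C - A^* y>]. It is affine in [X], so averaging such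
    functions averages the matrices. *)
Definition lagrangian X : affine R m := (A X - b, - mxip C X).

Lemma lagrangianE X y :
  aff_eval (lagrangian X) y = dotv (- b) y + dotv y (A X) - mxip C X.
Proof. by rewrite /aff_eval /= dotvBl dotvNl (dotvC (A X)); ring. Qed.

Section Penalty.
Variables (alpha : R) (alpha_ge0 : 0 <= alpha).

Lemma penalizedE y :
  penalized C A b alpha y = dotv (- b) y + alpha * violation y.
Proof. by rewrite /penalized /violation mulrN. Qed.

Lemma eigvec_choice_norm z v : eigvec_choice C A z v -> dotv v v <= 1.
Proof.
rewrite /eigvec_choice; case: ifP => _; last by move=> ->; rewrite dotv0l ler01.
by case=> v1 _; rewrite -enorm_sqr v1 expr1n.
Qed.

(** A unit eigenvector for a nonpositive smallest eigenvalue satisfies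
    [<v, slack z v> = - violation z]; if that eigenvalue is positive, both sides vanish. *)
Lemma cut_lagrangian z v : eigvec_choice C A z v ->
  Defs.cut C A b alpha z v = lagrangian (alpha *: outer v).
Proof.
move=> vz; rewrite /Defs.cut /aff_at /lagrangian /subgrad linearZ /= addrC mxipZr mxip_outer.
congr (_, _); rewrite penalizedE dotvDl dotvZl dotvNl (dotvC (A _)).
have q := quad_slack z v; suff : alpha * violation z = - alpha * dotv v (slack z *m v).
  by move=> ->; rewrite q; ring.
move: vz; rewrite /eigvec_choice /violation -/(slack z); case: ifP => [l0 [v1 ->]|/negbT].
  by rewrite min_l // dotvZr -enorm_sqr v1; ring.
by rewrite -ltNge => l0 ->; rewrite min_r ?ltW // dotv0l; ring.
Qed.

Lemma lagrangian_le v y : dotv v v <= 1 ->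
  aff_eval (lagrangian (alpha *: outer v)) y <= penalized C A b alpha y.
Proof.
move=> v1; rewrite lagrangianE penalizedE linearZ /= dotvZr mxipZr mxip_outer.
have h : - violation y <= dotv v (slack y *m v).
  apply: le_trans (quad_slack_violation y v).
  by rewrite mulNr lerN2 -[leRHS]mulr1 ler_wpM2l ?violation_ge0.
by have := ler_wpM2l alpha_ge0 h; rewrite quad_slack; lra.
Qed.

End Penalty.

End PenalizedDual.

(** * Complementary pairs of symmetric matrices *)

(** Split [u = p + q] with [p] in the range of [X] and [q] in that of [S]. Both [Y] and [S] kill
    [p]; since [X q = 0], the margin [mu] at [q] comes from [S] alone, and [k S] outweighs the
    negativity [kappa] of [Y]. *)
Lemma psd_add_complement (R : realType) (n : nat) (X S Y : symmx R n) (mu kappa k : R) :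
  symval S *m symval X = 0 -> symval Y *m symval X = 0 ->
  symval (X + S) \in unitmx ->
  (forall u, mu * dotv u u <= dotv u ((X + S) *m u)) ->
  (forall u, - kappa * dotv u u <= dotv u (Y *m u)) ->
  0 <= k -> kappa <= k * mu -> psd (Y + k *: S).
Proof.
move=> SX YX uN Nmu Yk k0 kmu u; set M := Y + k *: S.
have XS : symval X *m symval S = 0.
  by rewrite -(symval_tr X) -(symval_tr S) -trmx_mul SX trmx0.
have MX : symval M *m symval X = 0.
  by rewrite /= mulmxDl YX -scalemxAl SX scaler0 addr0.
pose w := invmx (symval (X + S)) *m u.
have -> : u = X *m w + S *m w by rewrite -mulmxDl mulKVmx.
set p := X *m w; set q := S *m w.
have Mp : M *m p = 0 by rewrite mulmxA MX mul0mx.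
rewrite mulmxDr Mp add0r dotvDl dotv_sym Mp dotv0l add0r quadD quadZ.
have := Nmu q; rewrite quadD [X *m q]mulmxA XS mul0mx dotv0r add0r => h.
have h1 := ler_wpM2l k0 h; have h2 := Yk q.
by have := ler_wpM2r (dotvv_ge0 q) kmu; lra.
Qed.

(* The rank condition makes the kernel of S equal to the range of X. *)
Lemma complementary_unit (R : realType) (n : nat) (X S : symmx R n) :
  psd X -> psd S -> symval S *m symval X = 0 -> (\rank X + \rank S = n)%N ->
  symval (X + S) \in unitmx.
Proof.
move=> pX pS SX rk; rewrite unitmxE unitfE; apply/det0P => -[v v0 vN].
have XS : symval X *m symval S = 0.
  by rewrite -(symval_tr X) -(symval_tr S) -trmx_mul SX trmx0.
have Nv : (X + S) *m v^T = 0.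
  by rewrite -[symval (X + S)]symval_tr -trmx_mul vN trmx0.
have qN : dotv v^T ((X + S) *m v^T) = 0 by rewrite Nv dotv0r.
move: qN; rewrite quadD => qN; have qX := pX v^T; have qS := pS v^T.
have Xv : X *m v^T = 0 by apply: psd_quad_eq0 => //; lra.
have Sv : S *m v^T = 0 by apply: psd_quad_eq0 => //; lra.
have vS : (v <= kermx S)%MS.
  by apply/sub_kermxP; rewrite -(symval_tr S) -[v]trmxK -trmx_mul Sv trmx0.
have XkS : (symval X <= kermx S)%MS by apply/sub_kermxP.
have kSX : (kermx S <= symval X)%MS.
  have := mxrank_leqif_sup XkS; rewrite mxrank_ker -[in X in (X - _)%N]rk addnK.
  by case=> _; rewrite eqxx => <-.
have /submxP[w vw] := submx_trans vS kSX.
have : dotv v^T v^T = 0 by rewrite dotvE trmxK {1}vw -mulmxA Xv mulmx0 mxE.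
move=> h; move/negP: v0; apply.
by rewrite -[v]trmxK (dotvv_le0 (_ : dotv v^T v^T <= 0)) ?h // trmx0.
Qed.

(** * Complementary solutions and a linear error bound *)

Section QuadraticGrowth.
Variables (R : realType) (n m : nat) (n_gt0 : (0 < n)%N).
Variables (C : symmx R n) (A : {linear symmx R n -> 'cV[R]_m}) (b : 'cV[R]_m).

Lemma dual_sol_value y y' : dual_sol C A b y -> dual_sol C A b y' ->
  dotv (- b) y = dotv (- b) y'.
Proof.
by move=> [fy oy] [fy' oy']; apply/eqP; rewrite eq_le oy ?oy'.
Qed.

(** The two hypotheses may provide different pairs; as all solutions of one problem share its
    optimal value, the strictly complementary pair has no duality gap either. *)
Lemma complementary_pair :
  strong_duality C A b -> strict_complementarity C A b ->
  exists (X : symmx R n) (y : 'cV[R]_m), [/\ psd X, A X = b, dual_sol C A b y,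
    dotv b y = mxip C X & (\rank X + \rank (slack C A y) = n)%N].
Proof.
move=> [X [y [sX sy e]]] [X' [y' [sX' sy' rk]]].
have [fX oX] := sX; have [fX' oX'] := sX'; exists X', y'; split=> //.
- by case: fX'.
- by case: fX'.
have := dual_sol_value sy sy'; rewrite -e.
have -> : mxip (- C) X = mxip (- C) X' by apply/eqP; rewrite eq_le oX ?oX'.
by rewrite mxipNl dotvNl => /eqP; rewrite eqr_opp => /eqP.
Qed.

Section LinearErrorBound.
Variables (k : nat) (B : 'M[R]_(n, k)).

(** The map [h |-> A^* h B] between row vectors, so that it has a matrix and a pseudo-inverse. *)
Definition adjoint_rows (h : 'rV[R]_m) : 'rV[R]_(n * k) := mxvec (adjoint A h^T *m B).

Lemma adjoint_rows_is_linear : linear adjoint_rows.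
Proof.
move=> a h h'; rewrite /adjoint_rows (_ : (_ + _)^T = a *: h^T + h'^T); last first.
  by rewrite linearD linearZ.
rewrite adjointD adjointZ.
by rewrite mulmxDl linearD /= -scalemxAl linearZ.
Qed.

HB.instance Definition _ :=
  GRing.isLinear.Build R 'rV[R]_m 'rV[R]_(n * k) *:%R adjoint_rows adjoint_rows_is_linear.

(** [h'] is the preimage of [A^* h B] picked by the pseudo-inverse, so its norm is controlled by
    that image alone. *)
Lemma adjoint_error_bound : exists2 c : R, 0 <= c & forall h a,
  (forall j, enorm (adjoint A h *m col j B) <= a) ->
  exists2 h', adjoint A h' *m B = adjoint A h *m B & enorm h' <= c * a.
Proof.
pose G := lin1_mx adjoint_rows.
have [c c0 Hc] := enorm_mulmx_bound (pinvmx G)^T.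
(* The image has [n k] entries, each bounded by [a] through its column. *)
exists (c * (n * k)%:R); first by rewrite mulr_ge0.
move=> h a Ha; pose w := adjoint_rows h^T.
have wG : (w <= G)%MS by apply/submxP; exists h^T; rewrite mul_rV_lin1.
exists (w *m pinvmx G)^T.
  have : adjoint_rows (w *m pinvmx G) = w by rewrite -mul_rV_lin1 mulmxKpV.
  by rewrite /w /adjoint_rows trmxK => /(can_inj mxvecK).
rewrite trmx_mul (le_trans (Hc _)) // -mulrA ler_wpM2l //.
rewrite (le_trans (enorm_le_sum_coord _)) //.
rewrite (_ : (n * k)%:R * a = \sum_(i < n * k) a); last first.
  by rewrite sumr_const card_ord mulr_natl.
apply: ler_sum => i _; case/mxvec_indexP: i => i j.
rewrite mxE mxvecE trmxK; apply: le_trans (Ha j).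
by have := coord_le_enorm (adjoint A h *m col j B) i; rewrite colE mulmxA -colE mxE.
Qed.

End LinearErrorBound.

End QuadraticGrowth.

(** * Quadratic growth of the penalized dual objective *)

Section PenaltyGap.
Variables (R : realType) (n m : nat) (n_gt0 : (0 < n)%N).
Variables (C : symmx R n) (A : {linear symmx R n -> 'cV[R]_m}) (b : 'cV[R]_m).
Variables (Xs : symmx R n) (ys : 'cV[R]_m) (alpha : R).
Hypotheses (psdX : psd Xs) (feasX : A Xs = b) (sol_ys : dual_sol C A b ys).
Hypothesis no_gap : dotv b ys = mxip C Xs.
Hypothesis rank_sum : (\rank Xs + \rank (slack C A ys) = n)%N.
Hypothesis alpha_large : \tr Xs + 1 <= alpha.

Notation S := (slack C A).
Notation viol := (violation C A).

Definition gap y : R := penalized C A b alpha y - dotv (- b) ys.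

Lemma mxip_slack y : mxip (S y) Xs = dotv b ys - dotv b y.
Proof. by rewrite mxipBl adjointP feasX no_gap (dotvC b y). Qed.

Lemma gapE y : gap y = mxip (S y) Xs + alpha * viol y.
Proof. by rewrite /gap penalizedE mxip_slack !dotvNl; ring. Qed.

Lemma trace_factor k (B : 'M[R]_(n, k)) : symval Xs = B *m B^T ->
  \tr Xs = \sum_j dotv (col j B) (col j B).
Proof.
move=> XB; have := mxip_factor (sympart 1%:M) XB.
rewrite /mxip sympart_scalar mul1mx => ->.
by apply: eq_bigr => j _; rewrite mul1mx.
Qed.

Lemma trace_ge0 : 0 <= \tr Xs.
Proof.
have [k [B XB]] := psd_factor psdX; rewrite (trace_factor XB).
by apply: sumr_ge0 => j _; exact: dotvv_ge0.
Qed.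

(** With [b_j] the columns of [B], the gap is the sum of the nonnegative
    [<b_j, (S y + viol y I) b_j>] plus [(alpha - tr Xs) viol y], where [alpha - tr Xs >= 1]; so it
    dominates each piece. *)
Lemma gap_terms k (B : 'M[R]_(n, k)) y : symval Xs = B *m B^T ->
  viol y <= gap y /\ forall j,
  dotv (col j B) (S y *m col j B) + viol y * dotv (col j B) (col j B) <= gap y.
Proof.
move=> XB; set s := viol y.
pose q j := dotv (col j B) (S y *m col j B) + s * dotv (col j B) (col j B).
have q0 j : 0 <= q j.
  by have := quad_slack_violation n_gt0 C A y (col j B); rewrite -/s /q; lra.
have s0 : 0 <= s := violation_ge0 C A y.
have gE : gap y = \sum_j q j + (alpha - \tr Xs) * s.
  rewrite gapE (mxip_factor _ XB) big_split /= -mulr_sumr -(trace_factor XB) -/s.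
  by ring.
have hs : s <= (alpha - \tr Xs) * s by rewrite ler_peMl //; move: alpha_large; lra.
have qs : 0 <= \sum_j q j by apply: sumr_ge0.
split=> [|j]; first by rewrite gE; lra.
rewrite -/(q j) gE (bigD1 j) //=.
have : 0 <= \sum_(i < k | i != j) q i by apply: sumr_ge0.
by lra.
Qed.

Lemma gap_ge_violation y : viol y <= gap y.
Proof. by have [k [B XB]] := psd_factor psdX; case: (gap_terms y XB). Qed.

Lemma gap_ge0 y : 0 <= gap y.
Proof. exact: le_trans (violation_ge0 C A y) (gap_ge_violation y). Qed.

(** Complementary slackness: with no duality gap, [<S ys, Xs>] is a vanishing sum of nonnegative
    forms. *)
Lemma slack_mul_factor k (B : 'M[R]_(n, k)) : symval Xs = B *m B^T ->
  forall j, S ys *m col j B = 0.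
Proof.
move=> XB j; have [fs _] := sol_ys; apply: psd_quad_eq0 => //.
have := mxip_factor (S ys) XB; rewrite mxip_slack subrr => /esym/eqP.
by rewrite psumr_eq0 => [/allP/(_ j)|i _]; [rewrite mem_index_enum => /(_ isT)/eqP | exact: fs].
Qed.

Lemma mulmx_col_eq0 k (M : 'M[R]_n) (B : 'M[R]_(n, k)) :
  (forall j, M *m col j B = 0) -> M *m B = 0.
Proof.
move=> H; apply/matrixP => i j; have /matrixP/(_ i 0) := H j.
by rewrite colE mulmxA -colE !mxE.
Qed.

Lemma slack_mul_primal : symval (S ys) *m symval Xs = 0.
Proof.
have [k [B XB]] := psd_factor psdX.
by rewrite XB mulmxA (mulmx_col_eq0 (slack_mul_factor XB)) mul0mx.
Qed.

Lemma dual_sol_face y : psd (S y) -> symval (S y) *m symval Xs = 0 -> dual_sol C A b y.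
Proof.
move=> pS SX; split=> // y' fy'; have [_ oys] := sol_ys.
have := mxip_slack y; rewrite /mxip SX mxtrace0 => /esym/eqP; rewrite subr_eq0 => /eqP e.
by rewrite dotvNl -e -dotvNl; exact: oys.
Qed.

Lemma slack_affine a y : S (ys + a *: (y - ys)) = a *: S y + (1 - a) *: S ys.
Proof.
rewrite /slack adjointD adjointZ adjointD -(scaleN1r ys) adjointZ scaleN1r.
apply/val_inj/matrixP => i j; rewrite !mxE; ring.
Qed.

(** The slack of [y'] vanishes on the range of [Xs], and mixing in [ys] with weight [k / (1 + k)]
    restores feasibility. The factor [1 + |y - ys|] appears because [y] is not yet known to stay
    bounded. *)
Lemma face_projection D : 0 <= D -> exists2 c : R, 0 <= c & forall y, gap y <= D ->
  exists k y', [/\ 0 <= k, dotv (y' - y) (y' - y) <= c * (1 + enorm (y - ys)) * gap y,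
    k ^+ 2 <= c * (1 + enorm (y - ys)) * gap y
    & dual_sol C A b (ys + (1 + k)^-1 *: (y' - ys))].
Proof.
move=> D0; have [l [B XB]] := psd_factor psdX.
have [t0 t00 St0] := quad_bound (S ys).
have [cA cA0 HA] := quad_adjoint_bound A.
have [cB cB0 HB] := adjoint_error_bound A B.
have [fs _] := sol_ys.
have uN := complementary_unit psdX fs slack_mul_primal rank_sum.
have [mu mu0 Nmu] := psd_unit_margin (psdD psdX fs) uN.
have al0 : 0 < alpha by have := trace_ge0; move: alpha_large; lra.
pose c1 := 2 * (t0 + cA + D) + 2 * (alpha * D).
have c10 : 0 <= c1 by rewrite !addr_ge0 // mulr_ge0 // ?addr_ge0 // mulr_ge0 // ltW.
pose c2 := 2 / mu ^+ 2 * (D + cA ^+ 2 * (cB ^+ 2 * c1)).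
have mu2 : 0 <= 2 / mu ^+ 2 by rewrite divr_ge0 // sqr_ge0.
have c20 : 0 <= c2.
  by rewrite mulr_ge0 // addr_ge0 // mulr_ge0 ?sqr_ge0 // mulr_ge0 // sqr_ge0.
exists (cB ^+ 2 * c1 + c2); first by rewrite addr_ge0 // mulr_ge0 // sqr_ge0.
move=> y yD; set f := gap y in yD *; set r := enorm (y - ys); set s := viol y.
have r0 : 0 <= r := enorm_ge0 _.
have s0 : 0 <= s := violation_ge0 C A y.
have f0 : 0 <= f := gap_ge0 y.
have [sf qf] := gap_terms y XB; rewrite -/s -/f in sf qf.
have s2 : s ^+ 2 <= D * f.
  by apply: le_trans (_ : s * f <= _); [rewrite expr2 ler_wpM2l|rewrite ler_wpM2r // (le_trans sf)].
(* The shift by the violation makes [psd_image_bound] applicable. *)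
pose T := S y + sympart s%:M.
have Tmul u : T *m u = S y *m u + s *: u.
  have -> : symval T = symval (S y) + s%:M by rewrite -sympart_scalar.
  by rewrite mulmxDl mul_scalar_mx.
have Tq u : dotv u (T *m u) = dotv u (S y *m u) + s * dotv u u.
  by rewrite Tmul dotvDr dotvZr.
have pT : psd T.
  by move=> u; rewrite Tq; have := quad_slack_violation n_gt0 C A y u; rewrite -/s; lra.
(* Passing from [S ys] to [S y] costs [cA r], and the shift costs [s]. *)
pose tau := t0 + cA * r + s.
have cAr : 0 <= cA * r by exact: mulr_ge0.
have tau0 : 0 <= tau by rewrite !addr_ge0.
have Ttau u : dotv u (T *m u) <= tau * dotv u u.
  have /ler_normlP[_ h1] := St0 u; have /ler_normlP[h2 _] := HA (y - ys) u.
  move: h1 h2; rewrite Tq !quad_slack quad_adjoint dotvBl -/r /tau => h1 h2.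
  by rewrite !mulrDl; lra.
(* Bounds [|S y b_j|^2] through [S y b_j = T b_j - s b_j] and [|b_j|^2 <= tr Xs <= alpha]. *)
pose a2 := 2 * (tau * f) + 2 * (s ^+ 2 * alpha).
have a20 : 0 <= a2.
  by rewrite addr_ge0 // mulr_ge0 // mulr_ge0 ?sqr_ge0 // ltW.
have a2le : a2 <= c1 * (1 + r) * f.
  have e1 : tau <= (t0 + cA + D) * (1 + r).
    have : 0 <= t0 * r by exact: mulr_ge0.
    have : 0 <= D * r by exact: mulr_ge0.
    by rewrite /tau mulrDr mulr1 !mulrDl; move: (le_trans sf yD); lra.
  have e2 : s ^+ 2 * alpha <= alpha * D * (1 + r) * f.
    rewrite mulrC -!mulrA ler_pM2l // (le_trans s2) // ler_wpM2l //.
    by rewrite ler_peMl // lerDl.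
  have := ler_wpM2r f0 e1; rewrite /a2 /c1; lra.
have Sb j : dotv (S y *m col j B) (S y *m col j B) <= a2.
  have -> : S y *m col j B = T *m col j B + (- s) *: col j B.
    by rewrite Tmul -addrA -scalerDl subrr scale0r addr0.
  apply: le_trans (dotvvD_le _ _) _; rewrite dotvvZ sqrrN lerD // ler_pM2l //.
    apply: le_trans (psd_image_bound _ pT tau0 Ttau) _.
    by rewrite ler_wpM2l // Tq.
  rewrite ler_wpM2l ?sqr_ge0 //.
  have : dotv (col j B) (col j B) <= \tr Xs.
    rewrite (trace_factor XB) (bigD1 j) //= lerDl.
    by apply: sumr_ge0 => i _; exact: dotvv_ge0.
  by move: alpha_large; lra.
have Sdiff : adjoint A (ys - y) = S y - S ys.
  rewrite adjointD -(scaleN1r y) adjointZ scaleN1r /slack.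
  by apply/val_inj/matrixP => i j; rewrite !mxE; ring.
have diffB j : adjoint A (ys - y) *m col j B = S y *m col j B.
  have -> : symval (adjoint A (ys - y)) = symval (S y) - symval (S ys) by rewrite Sdiff.
  by rewrite mulmxBl (slack_mul_factor XB) subr0.
(* Since [S ys] kills [B], [h'] satisfies [A^* h' B = S y B]; hence [S (y + h')] kills [B]. *)
have [|h' h'B h'a] := HB (ys - y) (Num.sqrt a2).
  by move=> j; rewrite diffB enorm_leP ?sqrtr_ge0 // sqr_sqrtr.
have h'2 : enorm h' ^+ 2 <= cB ^+ 2 * (c1 * (1 + r) * f).
  apply: le_trans (_ : (cB * Num.sqrt a2) ^+ 2 <= _).
    by rewrite ler_sqr ?nnegrE ?enorm_ge0 // mulr_ge0 // sqrtr_ge0.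
  by rewrite exprMn sqr_sqrtr // ler_wpM2l // sqr_ge0.
pose kappa := s + cA * enorm h'; pose y' := y + h'.
have cAh : 0 <= cA * enorm h' by rewrite mulr_ge0 ?enorm_ge0.
have Sy' : S y' = S y - adjoint A h' by rewrite /S adjointD opprD addrA.
have Sy'B : symval (S y') *m B = 0.
  apply: mulmx_col_eq0 => j.
  have -> : symval (S y') = symval (S y) - symval (adjoint A h') by rewrite Sy'.
  rewrite mulmxBl -diffB [in X in X - _]colE [in X in _ - X]colE !mulmxA.
  by rewrite h'B subrr.
have Sy'X : symval (S y') *m symval Xs = 0 by rewrite XB mulmxA Sy'B mul0mx.
(* The weight of [S ys] that offsets the negativity [kappa] of [S y'] in [psd_add_complement]. *)
pose k := kappa / mu.
have k0 : 0 <= k by rewrite divr_ge0 ?addr_ge0 // ltW.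
exists k, y'; split=> //.
- rewrite /y' addrC addKr -enorm_sqr (le_trans h'2) // !mulrA.
  by rewrite ler_wpM2r // ler_wpM2r ?addr_ge0 // lerDl.
- rewrite /k /kappa expr_div_n ler_pdivrMr ?exprn_gt0 //.
  have e1 : (s + cA * enorm h') ^+ 2 <= 2 * s ^+ 2 + 2 * (cA * enorm h') ^+ 2.
    by have := sqr_ge0 (s - cA * enorm h'); rewrite sqrrB sqrrD !mulr2n; lra.
  apply: le_trans e1 _; rewrite exprMn.
  have e2 := ler_wpM2l (sqr_ge0 cA) h'2.
  apply: le_trans (_ : 2 * (D + cA ^+ 2 * (cB ^+ 2 * c1)) * ((1 + r) * f) <= _).
    have : 0 <= D * f * r by rewrite !mulr_ge0.
    by rewrite (_ : 2 * _ * _ = 2 * (D * f + D * f * r + cA ^+ 2 * (cB ^+ 2 * (c1 * (1 + r) * f))));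
      [lra|ring].
  have -> : 2 * (D + cA ^+ 2 * (cB ^+ 2 * c1)) * ((1 + r) * f) = c2 * (1 + r) * f * mu ^+ 2.
    by rewrite /c2; field; rewrite gt_eqF.
  rewrite ler_wpM2r ?sqr_ge0 // ler_wpM2r // ler_wpM2r ?addr_ge0 // lerDr.
  by rewrite mulr_ge0 // sqr_ge0.
have k1 : 0 < 1 + k by rewrite ltr_pwDl.
have SE : S (ys + (1 + k)^-1 *: (y' - ys)) = (1 + k)^-1 *: (S y' + k *: S ys).
  rewrite slack_affine [RHS]scalerDr [in RHS]scalerA; congr (_ + _ *: _).
  by field; rewrite gt_eqF.
apply: dual_sol_face; rewrite SE.
  apply: psdZ; first by rewrite invr_ge0 ltW.
  apply: (psd_add_complement (kappa := kappa) slack_mul_primal Sy'X uN Nmu) => //.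
    move=> u; rewrite Sy' quadB.
    have := quad_slack_violation n_gt0 C A y u; have /ler_normlP[_] := HA h' u.
    by rewrite -/s /kappa opprD mulrDl !mulNr; lra.
  by rewrite /k divfK // gt_eqF.
by rewrite /= -scalemxAl mulmxDl -scalemxAl Sy'X slack_mul_primal scaler0 addr0 scaler0.
Qed.

(** In [face_projection] the solution stays within [R0] of [ys], while [k] and [|y' - y|] are of
    order [sqrt (1 + r)] for [r = |y - ys|]. This bounds [r], and then [1 + r] is absorbed into the
    constant. *)
Lemma quadratic_growth D R0 : 0 <= D ->
  (forall y, dual_sol C A b y -> enorm (y - ys) <= R0) ->
  exists2 c : R, 0 < c & forall y, gap y <= D -> enorm (y - ys) <= c /\
  exists2 y'', dual_sol C A b y'' & dotv (y - y'') (y - y'') <= c * gap y.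
Proof.
move=> D0 HR; have [c c0 Hc] := face_projection D0.
have R00 : 0 <= R0 by have := HR _ sol_ys; rewrite subrr enorm0.
pose H := c * D + 1; have H0 : 0 < H by rewrite ltr_pwDr // mulr_ge0.
(* Solves [r <= R0 + H + H R0^2 + (1 + r) / 2] for [r]. *)
pose r1 := 2 * (R0 + H + H * R0 ^+ 2) + 1.
have r10 : 0 < r1 by have := mulr_ge0 (ltW H0) (sqr_ge0 R0); rewrite /r1; lra.
pose c' := 2 * (c * (1 + r1)) * (1 + R0 ^+ 2).
have c'0 : 0 <= c' by rewrite !mulr_ge0 // addr_ge0 ?sqr_ge0 // ltW.
exists (r1 + c'); first by rewrite ltr_pwDl.
move=> y yD; have [k [y' [k0 hy hk sy]]] := Hc y yD.
have f0 := gap_ge0 y.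
set r := enorm (y - ys) in hy hk *; set f := gap y in yD f0 hy hk *.
have r0 : 0 <= r := enorm_ge0 _.
have k1 : 0 < 1 + k by rewrite ltr_pwDl.
set y'' := ys + _ in sy; have hR := HR _ sy.
have yy : y' - ys = (1 + k) *: (y'' - ys).
  by rewrite /y'' [X in _ *: X]addrC addKr scalerA mulfV ?scale1r // gt_eqF.
(* From [H x <= H^2 + x^2 / 4]; the slope [1/4], used twice, lets [r] be absorbed on the left. *)
have bnd x : 0 <= x -> x ^+ 2 <= c * (1 + r) * f -> x <= H + (1 + r) / 4.
  move=> x0 hx; have h1 : x ^+ 2 <= H * (1 + r).
    apply: le_trans hx _; rewrite mulrAC ler_wpM2r ?addr_ge0 // /H.
    by have := ler_wpM2l c0 yD; lra.
  have := sqr_ge0 (H - x / 2); rewrite sqrrB expr_div_n mulr2n => h2.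
  have h3 : H * x <= H * (H + (1 + r) / 4) by rewrite mulrDr; lra.
  by rewrite ler_pM2l in h3.
have hkb := bnd _ k0 hk.
have hyb : enorm (y' - y) <= H + (1 + r) / 4 by apply: bnd; rewrite ?enorm_ge0 ?enorm_sqr.
have kR : k * R0 <= H * R0 ^+ 2 + (1 + r) / 4.
  have h1 : k ^+ 2 <= H * (1 + r).
    apply: le_trans hk _; rewrite mulrAC ler_wpM2r ?addr_ge0 // /H.
    by have := ler_wpM2l c0 yD; lra.
  have h2 := sqr_ge0 (H * R0 - k / 2).
  have h3 : H * (k * R0) <= H * (H * R0 ^+ 2 + (1 + r) / 4).
    by nra.
  by rewrite ler_pM2l in h3.
have rb : r <= r1.
  have : r <= enorm (y' - y) + enorm (y' - ys).
    have -> : r = enorm (- (y' - y) + (y' - ys)) by congr (enorm _); rewrite opprB addrA subrK.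
    by rewrite (le_trans (ler_enormD _ _)) // enormN.
  rewrite yy enormZ gtr0_norm //.
  have := ler_wpM2l (ltW k1) hR; rewrite /r1; lra.
split; first by apply: le_trans rb _; rewrite lerDl.
exists y'' => //.
have -> : y - y'' = - (y' - y) + k *: (y'' - ys).
  have -> : k *: (y'' - ys) = (y' - ys) - (y'' - ys).
    by rewrite yy scalerDl scale1r [RHS]addrAC subrr add0r.
  by rewrite !opprB !addrA !subrK.
apply: le_trans (dotvvD_le _ _) _; rewrite dotvvN dotvvZ -[dotv (y'' - ys) _]enorm_sqr.
have R2 : enorm (y'' - ys) ^+ 2 <= R0 ^+ 2 by rewrite ler_sqr ?nnegrE ?enorm_ge0.
have e1 : c * (1 + r) * f <= c * (1 + r1) * f.
  by rewrite ler_wpM2r // ler_wpM2l // lerD2l.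
have e2 : k ^+ 2 * enorm (y'' - ys) ^+ 2 <= c * (1 + r1) * f * R0 ^+ 2.
  by rewrite ler_pM ?sqr_ge0 // (le_trans hk).
apply: le_trans (_ : c' * f <= _); last by rewrite ler_wpM2r // lerDr ltW.
by rewrite /c'; lra.
Qed.

End PenaltyGap.

(** * Evaluation of affine functions *)

Section AffineFunctions.
Variables (R : realType) (m : nat).
Implicit Types (f g : affine R m) (y z : 'cV[R]_m).

Lemma aff_evalD f g y : aff_eval (f + g) y = aff_eval f y + aff_eval g y.
Proof. by rewrite /aff_eval /aff_grad /= dotvDl; ring. Qed.

Lemma aff_evalZ a f y : aff_eval (a *: f) y = a * aff_eval f y.
Proof. by rewrite /aff_eval /aff_grad /= dotvZl mulrDr. Qed.

Lemma aff_eval_diff f y z : aff_eval f y = aff_eval f z + dotv (aff_grad f) (y - z).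
Proof. by rewrite /aff_eval dotvBr; ring. Qed.

Lemma aff_at_eval c (g y z : 'cV[R]_m) : aff_eval (aff_at c g z) y = c + dotv g (y - z).
Proof. by rewrite /aff_eval /aff_at /= dotvBr; ring. Qed.

End AffineFunctions.

(** * Descent and null steps of the bundle method *)

Section RunAnalysis.
Variables (R : realType) (n m : nat) (n_gt0 : (0 < n)%N).
Variables (C : symmx R n) (A : {linear symmx R n -> 'cV[R]_m}) (b : 'cV[R]_m).
Variables (alpha rho : R) (y1 : 'cV[R]_m).
Hypotheses (alpha_gt0 : 0 < alpha) (rho_gt0 : 0 < rho).
Variable r : bundle_run C A b alpha rho 2^-1 y1.
Variable M : R.
Hypothesis M_gt0 : 0 < M.
Hypothesis cut_grad_bound : forall v, dotv v v <= 1 ->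
  enorm (aff_grad (lagrangian C A b (alpha *: outer v))) <= M.

Notation F := (penalized C A b alpha).
Notation y_ := (run_y r).
Notation z_ := (run_z r).
Notation X_ := (run_X r).
Notation agg := (run_agg r).

Lemma run_eigvec_norm t : (0 < t)%N -> dotv (run_v r t) (run_v r t) <= 1.
Proof. by move=> t0; exact: eigvec_choice_norm (run_vP r t0). Qed.

Lemma run_cut_lagrangian t : (0 < t)%N ->
  run_cut r t = lagrangian C A b (alpha *: outer (run_v r t)).
Proof. by move=> t0; exact: cut_lagrangian (run_vP r t0). Qed.

Lemma run_aggS t : (0 < t)%N ->
  agg t.+1 = run_theta r t.+1 *: run_cut r t.+1 + (1 - run_theta r t.+1) *: agg t.
Proof. by move=> t0; rewrite /run_agg (run_FbarP r t0). Qed.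

Lemma run_agg1 : agg 1 = run_cut r 1.
Proof. by rewrite /run_agg run_Fbar1 run_theta1 /= scale1r. Qed.

(* The multipliers that average the cuts also average the rank-one matrices. *)
Lemma run_agg_lagrangian t : (0 < t)%N -> agg t = lagrangian C A b (X_ t.+1).
Proof.
elim: t => // -[|t] IH _.
  rewrite run_agg1 run_cut_lagrangian // run_XP // run_theta1.
  by rewrite mul1r subrr scale0r addr0.
rewrite run_aggS // IH // run_cut_lagrangian // [in RHS]run_XP // /lagrangian.
set th := run_theta r t.+2; set v := run_v r t.+2.
have -> (p q : affine R m) : th *: p + (1 - th) *: q =
  (th *: p.1 + (1 - th) *: q.1, th * p.2 + (1 - th) * q.2) by [].
congr (_, _) => /=.
  by rewrite (linearD A) !(linearZ_LR A) /=; apply/matrixP => i j; rewrite !mxE; ring.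
by rewrite mxipDr !mxipZr; ring.
Qed.

Lemma run_psd t : (0 < t)%N -> psd (X_ t).
Proof.
elim: t => // -[|t] IH _; first by rewrite run_X1; exact: psd0.
rewrite run_XP //; have /andP[th0 th1] := run_theta_itv r (ltn0Sn t).
apply: psdD; apply: psdZ.
- by rewrite mulr_ge0 // ltW.
- exact: psd_outer.
- by rewrite subr_ge0.
- exact: IH.
Qed.

Lemma run_cut_le t y : (0 < t)%N -> aff_eval (run_cut r t) y <= F y.
Proof.
by move=> t0; rewrite run_cut_lagrangian // lagrangian_le ?run_eigvec_norm ?ltW.
Qed.

Lemma run_agg_le t y : (0 < t)%N -> aff_eval (agg t) y <= F y.
Proof.
elim: t => // -[|t] IH _; first by rewrite run_agg1 run_cut_le.
have /andP[th0 th1] := run_theta_itv r (ltn0Sn t.+1).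
rewrite run_aggS // aff_evalD !aff_evalZ.
have h1 := ler_wpM2l th0 (@run_cut_le t.+2 y isT).
have th1' : 0 <= 1 - run_theta r t.+2 by rewrite subr_ge0.
by have := ler_wpM2l th1' (IH isT); lra.
Qed.

Lemma run_modelS t y : (0 < t)%N ->
  run_model r t.+1 y = Num.max (aff_eval (run_cut r t.+1) y) (aff_eval (agg t) y).
Proof. by move=> t0; rewrite /run_model (run_FbarP r t0). Qed.

Lemma run_cut_le_model t y : (0 < t)%N -> aff_eval (run_cut r t) y <= run_model r t y.
Proof.
case: t => // -[|t] _; first by rewrite /run_model run_Fbar1.
by rewrite run_modelS // le_max lexx.
Qed.

Lemma run_model_le t y : (0 < t)%N -> run_model r t y <= F y.
Proof.
case: t => // -[|t] _; first by rewrite /run_model run_Fbar1 run_cut_le.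
by rewrite run_modelS // ge_max run_cut_le // run_agg_le.
Qed.

Lemma run_cut_grad t : (0 < t)%N -> enorm (aff_grad (run_cut r t)) <= M.
Proof.
by move=> t0; rewrite run_cut_lagrangian // cut_grad_bound ?run_eigvec_norm.
Qed.

Lemma run_agg_grad t : (0 < t)%N -> enorm (aff_grad (agg t)) <= M.
Proof.
elim: t => // -[|t] IH _; first by rewrite run_agg1 run_cut_grad.
have /andP[th0 th1] := run_theta_itv r (ltn0Sn t.+1).
have th1' : 0 <= 1 - run_theta r t.+2 by rewrite subr_ge0.
rewrite run_aggS // /aff_grad (le_trans (ler_enormD _ _)) // !enormZ !ger0_norm //.
have h1 := ler_wpM2l th0 (@run_cut_grad t.+2 isT).
by have := ler_wpM2l th1' (IH isT); rewrite /aff_grad in h1 *; lra.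
Qed.

(** By [run_zP], the minimum of the model plus the proximal term. *)
Definition prox_value t : R :=
  run_model r t (z_ t.+1) + rho / 2 * dotv (z_ t.+1 - y_ t) (z_ t.+1 - y_ t).

Lemma prox_valueE t : prox_value t =
  run_model r t (z_ t.+1) + rho / 2 * dotv (z_ t.+1 - y_ t) (z_ t.+1 - y_ t).
Proof. by []. Qed.

Definition prox_gap t : R := F (y_ t) - prox_value t.

Lemma prox_gapE t : prox_gap t = F (y_ t) - (run_model r t (z_ t.+1)
  + rho / 2 * dotv (z_ t.+1 - y_ t) (z_ t.+1 - y_ t)).
Proof. by []. Qed.

#[local] Opaque penalized run_model prox_value prox_gap.

Lemma run_step t : (0 < t)%N -> aff_grad (agg t) = - (rho *: (z_ t.+1 - y_ t)).
Proof. by move=> t0; apply/eqP; rewrite -addr_eq0 run_theta_grad. Qed.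

(** The left side is a quadratic in [y] of curvature [rho]; the multiplier conditions make [z_ t.+1]
    its minimizer and [prox_value t] its minimum. *)
Lemma agg_prox t y : (0 < t)%N ->
  aff_eval (agg t) y + rho / 2 * dotv (y - y_ t) (y - y_ t) =
  prox_value t + rho / 2 * dotv (y - z_ t.+1) (y - z_ t.+1).
Proof.
move=> t0; rewrite (aff_eval_diff _ y (z_ t.+1)) run_theta_val // run_step //.
have -> : y - y_ t = (y - z_ t.+1) + (z_ t.+1 - y_ t) by rewrite addrA subrK.
rewrite dotvvD dotvNl dotvZl (dotvC (z_ _ - _) (y - _)) prox_valueE.
by field.
Qed.

Lemma prox_value_le t y : (0 < t)%N ->
  prox_value t <= F y + rho / 2 * dotv (y - y_ t) (y - y_ t).
Proof.
move=> t0; have := run_zP r t0 y; rewrite !enorm_sqr => h.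
by apply: le_trans h _; rewrite lerD2r run_model_le.
Qed.

(** Evaluates [agg_prox] at [y_ t], where the aggregate is at most [F]. *)
Lemma prox_step_le t : (0 < t)%N ->
  rho / 2 * dotv (z_ t.+1 - y_ t) (z_ t.+1 - y_ t) <= prox_gap t.
Proof.
move=> t0; have := agg_prox (y_ t) t0; rewrite subrr dotv0l mulr0 addr0.
have := run_agg_le (y_ t) t0; rewrite -(dotvvN (z_ _ - _)) opprB prox_gapE prox_valueE.
by lra.
Qed.

Lemma prox_gap_ge0 t : (0 < t)%N -> 0 <= prox_gap t.
Proof.
move=> t0; apply: le_trans (prox_step_le t0).
by rewrite mulr_ge0 ?dotvv_ge0 // divr_ge0 // ltW.
Qed.

Lemma eq_if_cases T (c : bool) (x a a' : T) : x = (if c then a else a') ->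
  c /\ x = a \/ ~~ c /\ x = a'.
Proof. by case: c => ->; [left|right]. Qed.

Lemma run_dichotomy t : (0 < t)%N ->
  (y_ t.+1 = z_ t.+1 /\ F (y_ t.+1) <= F (y_ t) - prox_gap t / 2) \/
  (y_ t.+1 = y_ t /\ F (z_ t.+1) > run_model r t (z_ t.+1) + prox_gap t / 2).
Proof.
move=> t0; have st := prox_step_le t0.
have q0 : 0 <= rho / 2 * dotv (z_ t.+1 - y_ t) (z_ t.+1 - y_ t).
  by rewrite mulr_ge0 ?dotvv_ge0 // divr_ge0 // ltW.
move: st q0; rewrite !prox_gapE.
set q := rho / 2 * _; set w := run_model r t _ => st q0.
case: (eq_if_cases (run_yP r t0)) => -[h ->]; [left|right]; (split; first by []).
  by apply: le_trans h _; move: q0 st; rewrite -/w; move: (F _) w q => f w q; lra.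
by move: h q0; rewrite -ltNge -/w; move: (F _) (F _) w q {st} => f f' w q; lra.
Qed.

Lemma run_value_noninc t : (0 < t)%N -> F (y_ t.+1) <= F (y_ t).
Proof.
move=> t0; have := prox_gap_ge0 t0.
case: (run_dichotomy t0) => [[_ h] d0|[-> _] _]; last exact: lexx.
by apply: le_trans h _; rewrite gerBl divr_ge0.
Qed.

(** The newest cut is then exact at [y_ t], and [young_dotv] limits how far its linear term can
    outrun the proximal one. *)
Lemma prox_gap_centered t : (0 < t)%N -> z_ t = y_ t ->
  prox_gap t <= M ^+ 2 / (2 * rho).
Proof.
move=> t0 zy; have h := run_cut_le_model (z_ t.+1) t0.
have := young_dotv (z_ t.+1 - y_ t) (aff_grad (run_cut r t)) rho_gt0.
have : dotv (aff_grad (run_cut r t)) (aff_grad (run_cut r t)) / (2 * rho)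
    <= M ^+ 2 / (2 * rho).
  rewrite ler_wpM2r ?invr_ge0 ?mulr_ge0 ?(ltW rho_gt0) //.
  by rewrite -enorm_leP ?run_cut_grad // ltW.
move: h; rewrite /run_cut /Defs.cut aff_at_eval zy /aff_grad /= mulNr.
by rewrite !prox_gapE; lra.
Qed.

(** The arithmetic of [null_step]: [a] and [p] are the aggregate and the new cut at [z_ t.+2], [w]
    and [W] the old and new model values, and the [Q] are proximal terms. *)
Lemma null_step_arith (l K Fy Fz W a p w g d d' Q0 Q1 Q2 : R) :
  a + l * (p - a) <= W -> p - a = Fz - w + g -> l * (w + d / 2) <= l * Fz ->
  a + Q0 = w + Q2 + Q1 -> d = Fy - (w + Q2) -> d' = Fy - (W + Q0) ->
  - K <= Q1 + l * g -> d' <= d - l * (d / 2) + K.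
Proof. by move=> h1 h2 h3 h4 h5 h6 h7; rewrite h2 in h1; lra. Qed.

(* On a null step the new model dominates every convex combination of the
   aggregate and of the new cut; [lambda] is the weight of the cut. *)
Lemma null_step t lambda : (0 < t)%N -> y_ t.+1 = y_ t ->
  F (z_ t.+1) > run_model r t (z_ t.+1) + prox_gap t / 2 -> 0 <= lambda <= 1 ->
  prox_gap t.+1 <= prox_gap t - lambda * (prox_gap t / 2) + lambda ^+ 2 * (2 * M ^+ 2 / rho).
Proof.
move=> t0 yy Fz /andP[l0 l1]; set y := z_ t.+2; set z := z_ t.+1.
set G := aff_grad (run_cut r t.+1) - aff_grad (agg t).
have model_ge : run_model r t.+1 y >=
    aff_eval (agg t) y + lambda * (aff_eval (run_cut r t.+1) y - aff_eval (agg t) y).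
  rewrite run_modelS //; set p := aff_eval (run_cut r _) _; set q := aff_eval _ _.
  have l1' : 0 <= 1 - lambda by rewrite subr_ge0.
  have h1 : p <= Num.max p q by rewrite le_max lexx.
  have h2 : q <= Num.max p q by rewrite le_max lexx orbT.
  by have := ler_wpM2l l0 h1; have := ler_wpM2l l1' h2; lra.
have diff : aff_eval (run_cut r t.+1) y - aff_eval (agg t) y =
    F z - run_model r t z + dotv G (y - z).
  rewrite (aff_eval_diff (agg t) y z) run_theta_val // (aff_eval_diff (run_cut r _) y z).
  rewrite {1}/run_cut /Defs.cut aff_at_eval subrr dotv0r /G dotvBl -/z; ring.
have young := young_dotv (y - z) (lambda *: G) rho_gt0.
have GM : dotv G G <= 4 * M ^+ 2.
  apply: le_trans (dotvvD_le _ _) _; rewrite dotvvN.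
  have : dotv (aff_grad (run_cut r t.+1)) (aff_grad (run_cut r t.+1)) <= M ^+ 2.
    by rewrite -enorm_leP ?run_cut_grad // ltW.
  have : dotv (aff_grad (agg t)) (aff_grad (agg t)) <= M ^+ 2.
    by rewrite -enorm_leP ?run_agg_grad // ltW.
  by lra.
have young' : - (lambda ^+ 2 * (2 * M ^+ 2 / rho)) <=
    rho / 2 * dotv (y - z) (y - z) + lambda * dotv G (y - z).
  rewrite -(dotvZl lambda); apply: le_trans young; rewrite dotvvZ mulNr lerN2.
  rewrite ler_pdivrMr ?mulr_gt0 //.
  have -> : lambda ^+ 2 * (2 * M ^+ 2 / rho) * (2 * rho) = lambda ^+ 2 * (4 * M ^+ 2).
    by field; rewrite gt_eqF.
  by rewrite ler_wpM2l ?sqr_ge0.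
have ap := agg_prox y t0; rewrite prox_valueE in ap.
have e' := prox_gapE t.+1; rewrite yy in e'.
exact: (null_step_arith model_ge diff (ler_wpM2l l0 (ltW Fz)) ap (prox_gapE t) e' young').
Qed.

Definition null_rate : R := rho / (32 * M ^+ 2).

Lemma null_rate_gt0 : 0 < null_rate.
Proof. by rewrite divr_gt0 // mulr_gt0 // exprn_gt0. Qed.

Lemma null_step_decrease t : (0 < t)%N -> prox_gap t <= M ^+ 2 / (2 * rho) ->
  y_ t.+1 = y_ t -> F (z_ t.+1) > run_model r t (z_ t.+1) + prox_gap t / 2 ->
  prox_gap t.+1 <= prox_gap t - null_rate * prox_gap t ^+ 2.
Proof.
move=> t0 dD yy Fz; have d0 := prox_gap_ge0 t0; set d := prox_gap t in dD d0 Fz *.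
(* This weight minimizes [- l d / 2 + 2 l^2 M^2 / rho], with minimum [- null_rate d^2], whence the
   32 in [null_rate]. The bound on [d] gives [l <= 1/16]. *)
have k0 := null_rate_gt0; pose l := 4 * null_rate * d.
have l0 : 0 <= l by rewrite mulr_ge0 // mulr_ge0 // ltW.
have l1 : l <= 1.
  apply: le_trans (_ : 4 * null_rate * (M ^+ 2 / (2 * rho)) <= _).
    by rewrite ler_wpM2l // mulr_ge0 // ltW.
  rewrite (_ : _ * _ = 16^-1); last by rewrite /null_rate; field; rewrite !gt_eqF.
  by rewrite invf_le1 // ler1n.
have := @null_step t l t0 yy Fz; rewrite l0 l1 => /(_ isT); rewrite -/d.
have -> : l ^+ 2 * (2 * M ^+ 2 / rho) = null_rate * d ^+ 2.
  by rewrite /l /null_rate; field; rewrite !gt_eqF.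
by rewrite /l => h; apply: le_trans h _; lra.
Qed.

(** At the start and after each descent step [z_ t = y_ t]; null steps only decrease the proximal
    gap. *)
Lemma prox_gap_bounded t : (0 < t)%N -> prox_gap t <= M ^+ 2 / (2 * rho).
Proof.
elim: t => // -[|t] IH _; first by apply: prox_gap_centered; rewrite ?run_z1 ?run_y1.
case: (run_dichotomy (ltn0Sn t)) => [[yz _]|[yy Fz]].
  by apply: prox_gap_centered.
apply: le_trans (null_step_decrease _ _ yy Fz) (le_trans _ (IH isT)); rewrite ?IH //.
by rewrite gerBl mulr_ge0 ?sqr_ge0 // ltW // null_rate_gt0.
Qed.

Lemma run_progress t : (0 < t)%N ->
  F (y_ t.+1) <= F (y_ t) - prox_gap t / 2 \/
  F (y_ t.+1) <= F (y_ t) /\ prox_gap t.+1 <= prox_gap t - null_rate * prox_gap t ^+ 2.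
Proof.
move=> t0; case: (run_dichotomy t0) => [[_ h]|[yy Fz]]; first by left.
right; split; first by rewrite yy lexx.
exact: null_step_decrease t0 (prox_gap_bounded t0) yy Fz.
Qed.

End RunAnalysis.

(** * Counting descent and null steps *)

(* Descent steps shrink the gap by a factor below [expR (- 4^-1)]; between two
   of them the reciprocal of the proximal gap grows by [kappa] at each step. *)
Section IterationCount.
Variables (R : realType) (delta d : nat -> R) (kappa e Delta : R).
Hypotheses (kappa_gt0 : 0 < kappa) (e_gt0 : 0 < e) (Delta_gt0 : 0 < Delta).
Hypothesis delta1 : delta 1 <= Delta.
Hypothesis delta_ge0 : forall t, (0 < t)%N -> 0 <= delta t.
Hypothesis delta_le : forall t, (0 < t)%N -> delta t <= 2 * d t.
Hypothesis progress : forall t, (0 < t)%N ->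
  delta t.+1 <= delta t - d t / 2 \/
  delta t.+1 <= delta t /\ d t.+1 <= d t - kappa * d t ^+ 2.

(** [j] counts the descent steps so far; the last one started from a gap of at least [e / 2]. Each
    run of null steps closed by a descent step is charged [1 + 1 / (kappa e)], the current one
    [1 / (kappa d_t)]. *)
Lemma iteration_invariant t : (0 < t)%N ->
  (forall s, (0 < s <= t)%N -> e < d s) ->
  exists j : nat, [/\ delta t <= Delta * expR (- (j%:R / 4)),
    j = 0%N \/ e / 2 <= Delta * expR (- (j.-1%:R / 4)) &
    t%:R <= 1 + j%:R * (1 + (kappa * e)^-1) + (kappa * d t)^-1].
Proof.
have ke0 : 0 < kappa * e by exact: mulr_gt0.
elim: t => // -[|t] IH _ big.
  have d1 : 0 < d 1 by apply: lt_trans (big 1%N isT).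
  exists 0%N; split; [|by left|].
    by rewrite mul0r oppr0 expR0 mulr1.
  by rewrite mul0r addr0 lerDl invr_ge0 mulr_ge0 // ltW.
have [//||j [hj he ht]] := IH.
  by move=> s /andP[s0 st]; apply: big; rewrite s0 ltnW.
have dt : e < d t.+1 by apply: big; rewrite leqnSn.
have dt' : e < d t.+2 by apply: big; rewrite leqnn.
have d0 := lt_trans e_gt0 dt; have d0' := lt_trans e_gt0 dt'.
case: (progress (ltn0Sn t)) => [desc|[dec null]].
  have dl := delta_le (ltn0Sn t); have dp := delta_ge0 (ltn0Sn t.+1).
  exists j.+1; split.
  (* The descent factor is [3/4], because the decrease [d / 2] is at least [delta / 4]. *)
  - have e14 : 3 / 4 <= expR (- 4^-1 : R) by apply: le_trans (expR_ge1Dx _); lra.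
    rewrite -natr1 mulrDl opprD expRD mul1r mulrA.
    apply: le_trans (_ : delta t.+1 * (3 / 4) <= _); first by lra.
    by rewrite ler_pM // ?delta_ge0 // divr_ge0.
  - by right; apply: le_trans hj; lra.
  - rewrite -natr1 -[j.+1%:R]natr1 mulrDl mul1r.
    have h1 : (kappa * d t.+1)^-1 <= (kappa * e)^-1.
      by rewrite lef_pV2 ?posrE ?mulr_gt0 // ler_pM2l // ltW.
    have h2 : 0 <= (kappa * d t.+2)^-1 by rewrite invr_ge0 mulr_ge0 // ltW.
    by move: ht h1 h2; lra.
exists j; split=> //; first exact: le_trans dec hj.
rewrite -natr1; suff : (kappa * d t.+1)^-1 + 1 <= (kappa * d t.+2)^-1 by move: ht; lra.
have kd : 0 < kappa * d t.+1 by exact: mulr_gt0.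
rewrite -[leRHS]mul1r ler_pdivlMr ?mulr_gt0 //.
apply: le_trans (_ : ((kappa * d t.+1)^-1 + 1) * (kappa * (d t.+1 - kappa * d t.+1 ^+ 2)) <= _).
  by rewrite ler_wpM2l ?addr_ge0 ?invr_ge0 ?(ltW kd) // ler_wpM2l ?(ltW kappa_gt0).
(* With [x = kappa d]: [(1 / x + 1) (x - x^2) = 1 - x^2]. *)
rewrite (_ : _ * _ = 1 - (kappa * d t.+1) ^+ 2); first by rewrite gerBl sqr_ge0.
by field; rewrite !gt_eqF.
Qed.

Lemma iteration_count L : 0 <= L -> ln (2 * Delta / e) <= L -> exists t : nat,
  [/\ (0 < t)%N, d t <= e & t%:R <= (2 + 4 * L) * (1 + (kappa * e)^-1) + 1].
Proof.
move=> L0 hL; have ke0 : 0 < kappa * e by exact: mulr_gt0.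
set P := 1 + _; set N := _ * P.
have P0 : 0 < P by rewrite ltr_pwDl // invr_ge0 ltW.
have N0 : 0 <= N by rewrite mulr_ge0 ?(ltW P0) // addr_ge0 // mulr_ge0.
(* If [d] exceeded [e] up to [T], the first integer above [N], the invariant would give [T <= N]. *)
pose T := (Num.truncn N).+1.
have NT : N < T%:R by exact: truncnS_gt.
have TN : T%:R <= N + 1 by rewrite /T -natr1 lerD2r truncn_le.
apply: contrapT => nex.
have big s : (0 < s <= T)%N -> e < d s.
  move=> /andP[s0 sT]; rewrite ltNge; apply/negP => ds; apply: nex; exists s; split=> //.
  by apply: le_trans TN; rewrite ler_nat.
have [j [hj he ht]] := @iteration_invariant T isT big.
have dT : e < d T by apply: big; rewrite leqnn.
have h1 : (kappa * d T)^-1 <= (kappa * e)^-1.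
  have dT0 := lt_trans e_gt0 dT.
  by rewrite lef_pV2 ?posrE ?mulr_gt0 // ler_pM2l // ltW.
have jL : j%:R <= 1 + 4 * L.
  case: he => [->|]; first by rewrite addr_ge0 // mulr_ge0.
  case: j {hj ht} => [|j] /= he; first by rewrite addr_ge0 // mulr_ge0.
  rewrite -natr1 addrC lerD2l.
  have : j%:R / 4 <= ln (2 * Delta / e).
    rewrite -ler_expR lnK ?posrE ?divr_gt0 ?mulr_gt0 // ler_pdivlMr //.
    rewrite -ler_pdivlMl ?expR_gt0 // -expRN; lra.
  by move: hL; lra.
have : N < N; last by rewrite ltxx.
apply: lt_le_trans NT (le_trans ht _).
apply: le_trans (_ : (j%:R + 1) * P <= _); first by rewrite mulrDl mul1r /P; lra.
by rewrite ler_wpM2r ?(ltW P0) //; lra.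
Qed.

End IterationCount.

(** Coordinates are continuous, hence bounded on [S], and their absolute values sum to a bound on
    the Euclidean norm. *)
Lemma compact_enorm_bounded (R : realType) (m : nat) (S : set 'cV[R]_m) y :
  compact S -> exists R0, forall x, S x -> enorm (x - y) <= R0.
Proof.
move=> cS; have Hi (i : 'I_m) : exists N : R, forall x, S x -> `|x i 0| <= N.
  have : compact [set x i 0 | x in S].
    apply: continuous_compact => //; apply: continuous_subspaceT.
    exact: coord_continuous.
  move=> /compact_bounded[N [_ HN]]; exists (N + 1) => x Sx.
  by apply: (HN (N + 1)); [rewrite ltrDl | exists x].
have [N HN] := choice Hi; exists (\sum_i N i + enorm y) => x Sx.
rewrite (le_trans (ler_enormD _ _)) // enormN lerD2r.
by rewrite (le_trans (enorm_le_sum_coord _)) // ler_sum // => i _; exact: HN.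
Qed.

(** * From the proximal gap to the accuracy bounds *)

Section AccuracyEstimate.
Variables (R : realType) (n m : nat).
Variables (C : symmx R n) (A : {linear symmx R n -> 'cV[R]_m}) (b : 'cV[R]_m).
Variables (alpha rho : R).
Hypotheses (alpha_gt0 : 0 < alpha) (rho_gt0 : 0 < rho).

(** The terms serve in turn the violation (at most [2 d]), the squared residual (at most [2 rho d])
    and the squared objective difference. *)
Definition accuracy_const Y : R :=
  2 + 2 * rho + 8 * (1 + alpha) ^+ 2 + 4 * rho * (2 * Y ^+ 2 + 4 / rho).

Lemma accuracy_bounds Y : [/\ 2 <= accuracy_const Y, 2 * rho <= accuracy_const Y
  & 8 * (1 + alpha) ^+ 2 + 4 * rho * (2 * Y ^+ 2 + 4 / rho) <= accuracy_const Y].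
Proof.
have a0 : 0 <= 8 * (1 + alpha) ^+ 2 by rewrite mulr_ge0 ?sqr_ge0.
have r0 := ltW rho_gt0.
have b0 : 0 <= 4 * rho * (2 * Y ^+ 2 + 4 / rho).
  by rewrite mulr_ge0 // ?mulr_ge0 // addr_ge0 ?divr_ge0 // mulr_ge0 ?sqr_ge0.
by rewrite /accuracy_const; split; lra.
Qed.

(* [g1] and [g1'] are the optimality gaps of [y] and [y'], [w] is the model
   value at [z], [v'] the violation at [y'] and [d] the proximal gap. *)
Lemma accuracy_estimate Y eps (y y' z : 'cV[R]_m) (X : symmx R n) (f g1 g1' v' d w : R) :
  0 < eps -> enorm y <= Y -> g1 <= 2 * d -> 0 <= d -> d <= 1 ->
  d * accuracy_const Y <= eps ->
  rho / 2 * dotv (z - y) (z - y) <= d -> g1' <= g1 -> v' <= g1' -> 0 <= v' ->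
  d = g1 + f - (w + rho / 2 * dotv (z - y) (z - y)) ->
  b - A X = rho *: (z - y) -> w = dotv (- b) z + dotv z (A X) - mxip C X ->
  g1' + f = dotv (- b) y' + alpha * v' ->
  [/\ enorm (b - A X) ^+ 2 <= eps, v' <= eps &
      `|dotv b y' - mxip C X| <= Num.sqrt eps].
Proof.
set Q := dotv (z - y) (z - y); have Q0 : 0 <= Q := dotvv_ge0 _.
move=> eps0 yY g2d d0 d1 dK st gy' vg v0 gp res W Fy'.
have [K2 Kr Ka] := accuracy_bounds Y.
have q0 : 0 <= rho / 2 * Q by rewrite mulr_ge0 // divr_ge0 // ltW.
have dKle c : c <= accuracy_const Y -> d * c <= eps.
  by move=> cK; apply: le_trans dK; rewrite ler_wpM2l.
have res2 : dotv (b - A X) (b - A X) <= 2 * rho * d.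
  rewrite res dotvvZ -/Q; have := ler_wpM2l (ltW rho_gt0) st.
  by rewrite expr2; lra.
split.
- by rewrite enorm_sqr (le_trans res2) // mulrC dKle.
- by apply: le_trans (dKle 2 K2); rewrite mulrC; exact: le_trans vg (le_trans gy' g2d).
rewrite -[`|_|]sqrtr_sqr ler_sqrt ?(ltW eps0) //.
(* [p] is of order [d], while the residual paired with [z] is only of order [sqrt d]; this is the
   source of [sqrt eps]. *)
pose p := w - (dotv (- b) y' + alpha * v') + alpha * v'.
have -> : dotv b y' - mxip C X = p + dotv (b - A X) z.
  by rewrite /p W dotvBl !dotvNl (dotvC z); ring.
set g := dotv (b - A X) z.
have z2 : dotv z z <= 2 * Y ^+ 2 + 4 / rho.
  have -> : z = y + (z - y) by rewrite addrC subrK.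
  apply: le_trans (dotvvD_le _ _) _; rewrite -/Q; apply: lerD.
    by rewrite ler_pM2l // -enorm_leP // (le_trans (enorm_ge0 y)).
  by rewrite ler_pdivlMr //; lra.
have g2 : g ^+ 2 <= 2 * rho * d * (2 * Y ^+ 2 + 4 / rho).
  apply: le_trans (dotv_CS_sqr _ _) _.
  by rewrite ler_pM ?dotvv_ge0.
have pE : p = g1 - g1' - (d + rho / 2 * Q) + alpha * v'.
  by rewrite /p -Fy' gp; ring.
have av0 : 0 <= alpha * v' by rewrite mulr_ge0 // ltW.
have av1 : alpha * v' <= alpha * (2 * d).
  rewrite ler_wpM2l ?(ltW alpha_gt0) //.
  exact: le_trans vg (le_trans gy' g2d).
have gy0 := le_trans v0 vg.
have ad0 : 0 <= alpha * d by rewrite mulr_ge0 // ltW.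
have p2 : p ^+ 2 <= (2 * (1 + alpha) * d) ^+ 2.
  rewrite -[leLHS]real_normK ?num_real // ler_sqr ?nnegrE ?normr_ge0 //; last first.
    by rewrite mulr_ge0 // mulr_ge0 // addr_ge0 // ltW.
  by rewrite ler_norml pE; apply/andP; split; lra.
apply: le_trans (dKle _ Ka).
apply: le_trans (_ : 2 * p ^+ 2 + 2 * g ^+ 2 <= _).
  by move: (p) (g) => q h; have := sqr_ge0 (q - h); lra.
have dd : d * (8 * (1 + alpha) ^+ 2 * d) <= d * (8 * (1 + alpha) ^+ 2 * 1).
  by rewrite ler_wpM2l // ler_wpM2l // mulr_ge0 ?sqr_ge0.
move: p2 g2 dd; rewrite !exprMn.
move: (p ^+ 2) (g ^+ 2) (2 * Y ^+ 2 + 4 / rho) ((1 + alpha) ^+ 2) => a1 a2 a3 a4.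
by move=> *; lra.
Qed.

End AccuracyEstimate.

(** * Gap and accuracy along a run *)

Section Accuracy.
Variables (R : realType) (n m : nat) (n_gt0 : (0 < n)%N).
Variables (C : symmx R n) (A : {linear symmx R n -> 'cV[R]_m}) (b : 'cV[R]_m).
Variables (Xs : symmx R n) (ys : 'cV[R]_m) (alpha rho : R) (y1 : 'cV[R]_m).
Hypotheses (psdX : psd Xs) (feasX : A Xs = b) (sol_ys : dual_sol C A b ys).
Hypothesis no_gap : dotv b ys = mxip C Xs.
Hypothesis alpha_large : \tr Xs + 1 <= alpha.
Hypotheses (alpha_gt0 : 0 < alpha) (rho_gt0 : 0 < rho).
Variable r : bundle_run C A b alpha rho 2^-1 y1.

Notation F := (penalized C A b alpha).
Notation gap_ := (gap C A b ys alpha).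

#[local] Opaque penalized run_model prox_value prox_gap.

Lemma gap_penalized y : F y = gap_ y + dotv (- b) ys.
Proof. by rewrite /gap subrK. Qed.

Lemma gap_le y y' : F y <= F y' -> gap_ y <= gap_ y'.
Proof. by rewrite !gap_penalized lerD2r. Qed.

Lemma gap_le_sub y y' a : F y <= F y' - a -> gap_ y <= gap_ y' - a.
Proof. by rewrite !gap_penalized (addrAC (gap_ y')) lerD2r. Qed.

Lemma gap_dual_sol y : dual_sol C A b y -> gap_ y = 0.
Proof.
move=> sy; have [fy _] := sy; apply: le_anti; apply/andP; split; last first.
  exact: (gap_ge0 n_gt0 psdX feasX no_gap alpha_large).
rewrite /gap penalizedE (dual_sol_value sy sol_ys) addrAC subrr add0r.
rewrite mulr_ge0_le0 ?(ltW alpha_gt0) //.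
by apply: violation_le => // u; rewrite oppr0 mul0r; exact: fy.
Qed.

#[local] Opaque gap.

Lemma run_gap_le t : (0 < t)%N -> gap_ (run_y r t) <= gap_ y1.
Proof.
move=> /prednK <-; elim: t.-1 => [|k IH]; first by rewrite run_y1 lexx.
apply: le_trans IH; apply: gap_le; exact: (run_value_noninc n_gt0 alpha_gt0 rho_gt0 r (ltn0Sn k)).
Qed.

(** Tests the proximal minimum at the nearby solution [y]: the proximal term costs at most half of
    the gap, so the other half remains in [prox_gap]. *)
Lemma gap_le_prox_gap c t : (0 < t)%N -> rho * c <= 1 ->
  (exists2 y, dual_sol C A b y &
    dotv (run_y r t - y) (run_y r t - y) <= c * gap_ (run_y r t)) ->
  gap_ (run_y r t) <= 2 * prox_gap r t.
Proof.
move=> t0 rc [y sy hy]; have g0 := gap_ge0 n_gt0 psdX feasX no_gap alpha_large (run_y r t).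
have := prox_value_le n_gt0 alpha_gt0 r y t0.
rewrite (gap_penalized y) (gap_dual_sol sy) add0r -(dotvvN (y - _)) opprB prox_valueE => h.
rewrite prox_gapE gap_penalized.
have h1 := ler_wpM2l (ltW rho_gt0) hy; have h2 := ler_wpM2r g0 rc.
move: h h1 h2; set w := run_model _ _ _.
move: (dotv (run_y r t - y) _) (gap_ _) w (dotv (- b) _) (dotv _ _).
by move=> q g w f q'; lra.
Qed.

Lemma run_accuracy Y t eps : (0 < t)%N -> 0 < eps ->
  enorm (run_y r t) <= Y -> gap_ (run_y r t) <= 2 * prox_gap r t ->
  prox_gap r t <= 1 -> prox_gap r t * accuracy_const alpha rho Y <= eps ->
  [/\ enorm (b - A (run_X r t.+1)) ^+ 2 <= eps, psd (run_X r t.+1),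
      - eps <= lambda_min (C - adjoint A (run_y r t.+1)) &
      `|dotv b (run_y r t.+1) - mxip C (run_X r t.+1)| <= Num.sqrt eps].
Proof.
move=> t0 eps0 yY g2d d1 dK.
have gy' := gap_le (run_value_noninc n_gt0 alpha_gt0 rho_gt0 r t0).
have gp := prox_gapE r t; rewrite gap_penalized in gp.
have vg := gap_ge_violation n_gt0 psdX feasX no_gap alpha_large (run_y r t.+1).
have res : b - A (run_X r t.+1) = rho *: (run_z r t.+1 - run_y r t).
  have e := run_step r t0; rewrite run_agg_lagrangian // in e.
  by rewrite -[RHS]opprK -e opprB.
have W : run_model r t (run_z r t.+1) = dotv (- b) (run_z r t.+1)
    + dotv (run_z r t.+1) (A (run_X r t.+1)) - mxip C (run_X r t.+1).
  by rewrite -run_theta_val // run_agg_lagrangian // lagrangianE.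
have Fy' := penalizedE C A b alpha (run_y r t.+1); rewrite gap_penalized in Fy'.
have [h1 h2 h3] := accuracy_estimate alpha_gt0 rho_gt0 eps0 yY g2d
  (prox_gap_ge0 n_gt0 alpha_gt0 rho_gt0 r t0) d1 dK
  (prox_step_le n_gt0 alpha_gt0 r t0) gy' vg (violation_ge0 C A _) gp res W Fy'.
split; [exact: h1 | exact: (run_psd alpha_gt0) | | exact: h3].
move: h2; rewrite /violation lerNl => h; apply: le_trans h _.
by rewrite ge_min lexx.
Qed.

End Accuracy.

(** * Choice of constants and the iteration bound *)

(** Since [ln (2 + 1 / eps) >= ln 2], additive constants are absorbed as multiples of the logarithm.
    The [+ 2] covers the [+ 1] of [iteration_count] and the shift from [t] to [t + 1]. *)
Lemma iteration_budget (R : realType) (Delta K kappa : R) :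
  0 < Delta -> 0 < K -> 0 < kappa ->
  exists2 B : R, 0 < B & forall eps, 0 < eps -> exists2 L : R, 0 <= L &
    ln (2 * Delta / (K * (1 + 1 / eps))^-1) <= L /\
    (2 + 4 * L) * (1 + (kappa * (K * (1 + 1 / eps))^-1)^-1) + 2
      <= B * (1 + 1 / eps) * ln (2 + 1 / eps) `^ 1.
Proof.
move=> D0 K0 k0; pose l2 : R := ln 2.
have l20 : 0 < l2 by rewrite ln_gt0 // ltr1n.
pose a := `|ln (2 * Delta * K)|; have a0 : 0 <= a := normr_ge0 _.
pose L0 := a / l2 + 1.
have L00 : 0 <= L0 by rewrite addr_ge0 // divr_ge0 // ltW.
have q0 : 0 <= K / kappa by rewrite divr_ge0 // ltW.
exists ((2 / l2 + 4 * L0) * (1 + K / kappa) + 2 / l2).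
  have r2 : 0 < 2 / l2 by rewrite divr_gt0.
  apply: (ltr_wpDl _ r2); apply: mulr_ge0; last exact: addr_ge0 ler01 q0.
  by apply: addr_ge0; [exact: ltW r2|exact: mulr_ge0 (ler0n _ 4) L00].
move=> eps eps0; set x := 1 + 1 / eps; pose l := ln (2 + 1 / eps).
have x1 : 1 <= x by rewrite lerDl divr_ge0 // ltW.
have x0 : 0 < x by apply: lt_le_trans x1.
have i0 : 0 <= 1 / eps by rewrite divr_ge0 // ltW.
have p0 : 0 < 2 + 1 / eps by rewrite ltr_pwDl.
have ll2 : l2 <= l by rewrite ler_ln ?posrE // lerDl.
have lx : ln x <= l by rewrite ler_ln ?posrE // lerD2r ler1n.
have l0 : 0 < l by apply: lt_le_trans ll2.
have al : a <= a / l2 * l.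
  by rewrite mulrAC ler_pdivlMr // ler_wpM2l.
exists (L0 * l); first by rewrite mulr_ge0 // ltW.
split.
  have -> : L0 * l = a / l2 * l + l by rewrite /L0 mulrDl mul1r.
  rewrite invrK mulrA lnM ?posrE ?mulr_gt0 //; apply: lerD lx.
  by apply: le_trans al; exact: ler_norm.
rewrite -/l powRr1 ?(ltW l0) // invfM invrK.
have h2 : 2 <= 2 / l2 * l by rewrite mulrAC ler_pdivlMr // ler_pM2l.
have hx : 1 + kappa^-1 * (K * x) <= (1 + K / kappa) * x.
  by rewrite mulrDl mul1r mulrA [_ * K]mulrC lerD2r.
have r0 : 0 <= 2 / l2 * l by rewrite mulr_ge0 ?divr_ge0 // ltW.
apply: le_trans (_ : (2 / l2 * l + 4 * (L0 * l)) * ((1 + K / kappa) * x) + 2 / l2 * l * x <= _).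
  apply: lerD; last by apply: le_trans h2 _; rewrite ler_peMr.
  apply: ler_pM => //; last by rewrite lerD2r.
    by rewrite addr_ge0 // mulr_ge0 // mulr_ge0 // ltW.
  by rewrite addr_ge0 // mulr_ge0 ?invr_ge0 ?mulr_ge0 // ltW.
by rewrite le_eqVlt; apply/orP; left; apply/eqP; ring.
Qed.

Theorem theorem1p1 (R : realType) (n m : nat) (n_gt0 : (0 < n)%N)
    (C : symmx R n) (A : {linear symmx R n -> 'cV[R]_m}) (b : 'cV[R]_m)
    (primal_compact : compact [set symval X | X in primal_sol C A b])
    (dual_compact : compact (dual_sol C A b))
    (sd : strong_duality C A b)
    (sc : strict_complementarity C A b)
    (y1 : 'cV[R]_m) :
  exists K k : R, 0 < K /\ 0 < k /\
  forall eps : R, 0 < eps ->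
  exists alpha rho beta : R,
    0 < alpha /\ 0 < rho /\ 0 < beta < 1 /\
    forall r : bundle_run C A b alpha rho beta y1,
    exists t : nat,
      (0 < t)%N /\
      t%:R <= K * (1 + 1 / eps) * (ln (2 + 1 / eps)) `^ k /\
      enorm (b - A (run_X r t)) ^+ 2 <= eps /\
      psd (run_X r t) /\
      - eps <= lambda_min (C - adjoint A (run_y r t)) /\
      `|dotv b (run_y r t) - mxip C (run_X r t)| <= Num.sqrt eps.
Proof.
have [Xs [ys [psdX feasX sol_ys no_gap rk]]] := complementary_pair sd sc.
pose alpha := \tr Xs + 1; have alpha_large : \tr Xs + 1 <= alpha := lexx _.
have alpha_gt0 : 0 < alpha by rewrite ltr_pwDr // (trace_ge0 psdX).
have [R0 HR] := compact_enorm_bounded ys dual_compact.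
have gap1 := gap_ge0 n_gt0 psdX feasX no_gap alpha_large y1.
have [c c0 growth] :=
  quadratic_growth n_gt0 psdX feasX sol_ys no_gap rk alpha_large gap1 HR.
(* With [c] the growth constant, this meets the condition [rho c <= 1] of [gap_le_prox_gap]. *)
pose rho := c^-1; have rho_gt0 : 0 < rho by rewrite invr_gt0.
have rho_c : rho * c <= 1 by rewrite mulVf ?gt_eqF.
have [cA cA0 HA] := enorm_image_outer A.
pose M := alpha * cA + enorm b + 1.
have M_gt0 : 0 < M.
  by rewrite ltr_pwDr // addr_ge0 ?enorm_ge0 // mulr_ge0 // ltW.
have HM v : dotv v v <= 1 ->
    enorm (aff_grad (lagrangian C A b (alpha *: outer v))) <= M.
  move=> v1; rewrite /aff_grad /= (linearZ_LR A) /=.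
  apply: le_trans (ler_enormD _ _) _; rewrite enormN enormZ gtr0_norm //.
  apply: le_trans (_ : alpha * cA + enorm b <= _); last by rewrite lerDl.
  rewrite lerD2r ler_pM2l //; apply: le_trans (HA v) _.
  by rewrite -[leRHS]mulr1 ler_wpM2l.
pose Y := enorm ys + c.
have [K2 _ _] := accuracy_bounds alpha rho_gt0 Y.
set K := accuracy_const alpha rho Y in K2.
have K_gt0 : 0 < K by apply: lt_le_trans K2.
(* The added 1 keeps the initial bound positive even when [y1] is optimal. *)
have Delta_gt0 : 0 < gap C A b ys alpha y1 + 1 by rewrite ltr_pwDr.
have kappa_gt0 := null_rate_gt0 rho_gt0 M_gt0.
have [B B0 budget] := iteration_budget Delta_gt0 K_gt0 kappa_gt0.
exists B, 1; split; first exact: B0.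
split; first exact: ltr01.
move=> eps eps0; exists alpha, rho, 2^-1.
split; first exact: alpha_gt0.
split; first exact: rho_gt0.
split; first by rewrite invr_gt0 ltr0n invf_lt1 ?ltr1n ?ltr0n.
move=> r; have [L L0 [lnL BL]] := budget eps eps0.
(* Then [K e = eps / (1 + eps) <= eps], and [K >= 2] gives [e <= 1], as [run_accuracy] requires. *)
set e := (K * (1 + 1 / eps))^-1 in lnL BL.
have inv0 : 0 < 1 / eps by rewrite divr_gt0.
have e_gt0 : 0 < e by rewrite invr_gt0 mulr_gt0 // addr_gt0.
(* Values never increase along a run, so growth on the sublevel set of [y1] applies to every
   [y_t]. *)
have bounds t (t0 : (0 < t)%N) := growth _ (run_gap_le n_gt0 ys alpha_gt0 rho_gt0 r t0).
have g2d t (t0 : (0 < t)%N) := gap_le_prox_gap n_gt0 psdX feasX sol_ys no_gap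
  alpha_large alpha_gt0 rho_gt0 t0 rho_c (proj2 (bounds t t0)).
have delta1 : gap C A b ys alpha (run_y r 1) <= gap C A b ys alpha y1 + 1.
  by rewrite run_y1 lerDl.
have progress t : (0 < t)%N ->
    gap C A b ys alpha (run_y r t.+1) <= gap C A b ys alpha (run_y r t) - prox_gap r t / 2 \/
    gap C A b ys alpha (run_y r t.+1) <= gap C A b ys alpha (run_y r t) /\
    prox_gap r t.+1 <= prox_gap r t - null_rate rho M * prox_gap r t ^+ 2.
  move=> t0; case: (run_progress n_gt0 alpha_gt0 rho_gt0 r M_gt0 HM t0) => [h|[h1 h2]].
    by left; exact: gap_le_sub h.
  by right; split; [exact: gap_le h1 | exact: h2].
have [t [t0 te tN]] := iteration_count kappa_gt0 e_gt0 Delta_gt0 delta1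
  (fun t _ => gap_ge0 n_gt0 psdX feasX no_gap alpha_large (run_y r t)) g2d progress L0 lnL.
have Ke : K * e = (1 + 1 / eps)^-1.
  by rewrite /e invfM mulrA mulfV ?mul1r // gt_eqF.
have yY : enorm (run_y r t) <= Y.
  have -> : run_y r t = ys + (run_y r t - ys) by rewrite addrC subrK.
  apply: le_trans (ler_enormD _ _) _; rewrite lerD2l; exact: (proj1 (bounds t t0)).
have eK : e * K <= eps.
  rewrite mulrC Ke; apply: le_trans (_ : (1 / eps)^-1 <= _).
    by rewrite lef_pV2 ?posrE ?addr_gt0 // lerDr.
  by rewrite div1r invrK.
have e_le1 : e <= 1.
  rewrite invf_le1; last by rewrite mulr_gt0 // addr_gt0.
  apply: le_trans (_ : 2 * 1 <= _); first by rewrite mulr1 ler1n.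
  by rewrite ler_pM // lerDl ltW.
have dK : prox_gap r t * K <= eps.
  by apply: le_trans eK; rewrite ler_wpM2r // ltW.
have [h1 h2 h3 h4] := run_accuracy n_gt0 psdX feasX no_gap alpha_large alpha_gt0
  rho_gt0 t0 eps0 yY (g2d t t0) (le_trans te e_le1) dK.
(* A small proximal gap at [t] certifies the pair produced by that step, which has index [t + 1]. *)
exists t.+1; split; first exact: ltn0Sn.
split; last by split; [exact: h1 | split; [exact: h2 | split; [exact: h3 | exact: h4]]].
apply: le_trans BL; rewrite -natr1.
apply: le_trans (_ : (2 + 4 * L) * (1 + (null_rate rho M * e)^-1) + 1 + 1 <= _).
  by rewrite lerD2r; exact: tN.
by rewrite -addrA lexx.
Qed.
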